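(* Let $G$ be an abelian cyclically ordered group. (1) If $G$ is infinite, c-regular and discrete, and $U$ is a non principal ultrafilter on $\mathbb{N}^*$, then $G$ is elementarily equivalent to the ultraproduct of the cyclically ordered groups $\mathbb{Z}/n\mathbb{Z}$ ($n\in\mathbb{N}^*$) modulo $U$ if and only if the family of subsets of $\mathbb{N}^*$ characteristic of $G$ is the same as the family of subsets of $\mathbb{N}^*$ defined by $U$. (2) $G$ is c-regular and discrete if and only if there exists an ultrafilter $U$ on $\mathbb{N}^*$ such that $G$ is elementarily equivalent to the ultraproduct of the cyclically ordered groups $\mathbb{Z}/n\mathbb{Z}$ modulo $U$.
   Context: All groups are abelian, written additively; $\mathbb{N}^*$ is the set of positive integers. A cyclically ordered group $(G,R)$ is an abelian group $G$ with a ternary relation $R$ such that: $R(a,b,c)$ implies that $a,b,c$ are pairwise distinct; $R(a,b,c)\Rightarrow R(b,c,a)$; for every $c\in G$, $R(c,\cdot,\cdot)$ is a strict linear order on $G\setminus\{c\}$; $R(a,b,c)\Rightarrow R(a+u,b+u,c+u)$. Elementary equivalence and ultraproducts are in the language of groups together with $R$. The cyclic order on $\mathbb{Z}/n\mathbb{Z}$ is: for representatives $0\le a,b,c<n$, $R(\bar a,\bar b,\bar c)$ iff $a<b<c$ or $b<c<a$ or $c<a<b$. $G$ is discrete if it is trivial or $G\setminus\{0\}$ has a smallest element for the order $R(0,\cdot,\cdot)$; in the nontrivial case this smallest element is denoted $1_G$ (it is definable). $R(x_1,\dots,x_m)$ (with $m\ge3$) means that $R(x_i,x_j,x_k)$ holds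 for all $1\le i<j<k\le m$; $R(x_1,x_2)$ means $x_1\ne x_2$. For $n\ge2$, $(G,R)$ is c-$n$-regular if for all $x_1,\dots,x_n\in G$ with $R(0,x_1,\dots,x_n)$ there is $x\in G$ such that ($nx=x_1$ or $nx=x_n$ or $R(x_1,nx,x_n)$) and $R(0,x,\dots,(n-1)x,x_n)$. $G$ is c-regular if it is c-$n$-regular for every $n\ge2$. For $G$ discrete and infinite, $p$ prime, $n\in\mathbb{N}^*$ and $k\in\{0,\dots,p^n-1\}$, $D_{p^n,k}$ is the formula $\exists x,\; R(0,x,2x,\dots,(p^n-1)x)\wedge p^nx=k1_G$. If $G$ is infinite, c-regular and discrete, there is a unique sequence $(\varphi_p)_{p\text{ prime}}$ of maps $\varphi_p:\mathbb{N}^*\to\{0,\dots,p-1\}$ such that for all $p,n,k$: $D_{p^n,k}$ holds in $G$ iff $k=\varphi_p(1)+\varphi_p(2)p+\cdots+\varphi_p(n)p^{n-1}$; it is the characteristic sequence of $G$. For a sequence $(\varphi_p)_{p\text{ prime}}$ of maps $\varphi_p:\mathbb{N}^*\to\{0,\dots,p-1\}$, put $N_{p^n,\varphi_p}=p^n\mathbb{N}^*-\sum_{k=1}^n p^{k-1}\varphi_p(k)=\{p^nm-\sum_{k=1}^np^{k-1}\varphi_p(k): m\in\mathbb{N}^*\}$. The set of all $N_{p^n,\varphi_p}$ ($p$ prime, $n\in\mathbb{N}^*$) is the family of subsets of $\mathbb{N}^*$ characteristic of $(\varphi_p)$. The family characteristic of $G$ is the family characteristic of the characteristic sequence of $G$.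 For each ultrafilter $U$ on $\mathbb{N}^*$ there is exactly one sequence $(\varphi_p)$ whose characteristic family is contained in $U$; that family is called the family of subsets of $\mathbb{N}^*$ defined by $U$. *)

(* Defs.v *)
From HB Require Import structures.
From mathcomp Require Import all_boot all_order all_algebra.
From mathcomp Require Import all_classical.
From mathcomp Require Import zify.

Set Implicit Arguments.
Unset Strict Implicit.
Unset Printing Implicit Defensive.

Import GRing.Theory.
Local Open Scope classical_set_scope.
Local Open Scope ring_scope.

(** * Cyclically ordered abelian groups *)

(* [cyc_trans] and [cyc_total] say, together with [cyc_neq], that
   [cyc c _ _] is a strict linear order on the complement of [c]. *)
HB.mixin Record isCyclicallyOrdered G of GRing.Zmodule G := {
  cyc : G -> G -> G -> Prop;
  cyc_neq : forall a b c, cyc a b c -> [/\ a <> b, b <> c & a <> c];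
  cyc_rot : forall a b c, cyc a b c -> cyc b c a;
  cyc_trans : forall c x y z, cyc c x y -> cyc c y z -> cyc c x z;
  cyc_total : forall c x y, x <> c -> y <> c -> x <> y ->
    cyc c x y \/ cyc c y x;
  cyc_add : forall a b c u, cyc a b c -> cyc (a + u) (b + u) (c + u)
}.

#[short(type="cogType")]
HB.structure Definition CyclicallyOrderedGroup :=
  {G of isCyclicallyOrdered G & GRing.Zmodule G}.

(** * First-order logic in the language of groups together with R *)

(* Terms and formulas with free variables among [n] de Bruijn indices;
   [FEx] binds index 0. *)
Inductive term (n : nat) : Type :=
| TVar of 'I_n
| TZero
| TOpp of term n
| TAdd of term n & term n.

Arguments TZero {n}.

Inductive formula : nat -> Type :=
| FEq n of term n & term n : formula n
| FCyc n of term n & term n & term n : formula n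
| FNot n of formula n : formula n
| FAnd n of formula n & formula n : formula n
| FEx n of formula n.+1 : formula n.

Definition sentence := formula 0.

Fixpoint eval (G : cogType) n (e : n.-tuple G) (t : term n) : G :=
  match t with
  | TVar i => tnth e i
  | TZero => 0
  | TOpp t1 => - eval e t1
  | TAdd t1 t2 => eval e t1 + eval e t2
  end.

Fixpoint sat (G : cogType) n (f : formula n) : n.-tuple G -> Prop :=
  match f in formula n return n.-tuple G -> Prop with
  | FEq _ t1 t2 => fun e => eval e t1 = eval e t2
  | FCyc _ t1 t2 t3 => fun e => cyc (eval e t1) (eval e t2) (eval e t3)
  | FNot _ f1 => fun e => ~ sat f1 e
  | FAnd _ f1 f2 => fun e => sat f1 e /\ sat f2 e
  | FEx _ f1 => fun e => exists x : G, sat f1 [tuple of x :: e]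
  end.

Definition elementarily_equivalent (G H : cogType) : Prop :=
  forall f : sentence, sat f [tuple of [::] : seq G] <-> sat f [tuple of [::] : seq H].

(** * Ultraproducts of cyclically ordered groups *)

Section Ultraproduct.
Variables (I : Type) (U : set_system I) (UF : UltraFilter U) (G : I -> cogType).

Definition dep_prod : Type := forall i, G i.

HB.instance Definition _ := Choice.copy dep_prod (forall i, G i).

Let dadd (x y : dep_prod) : dep_prod := fun i => x i + y i.
Let dopp (x : dep_prod) : dep_prod := fun i => - x i.
Let dzero : dep_prod := fun i => 0.

Let daddA : associative dadd.
Proof. by move=> x y z; apply: functional_extensionality_dep => i; rewrite /dadd addrA. Qed.
Let daddC : commutative dadd.
Proof. by move=> x y; apply: functional_extensionality_dep => i; rewrite /dadd addrC. Qed.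
Let dadd0 : left_id dzero dadd.
Proof. by move=> x; apply: functional_extensionality_dep => i; rewrite /dadd add0r. Qed.
Let daddN : left_inverse dzero dopp dadd.
Proof. by move=> x; apply: functional_extensionality_dep => i; rewrite /dadd addNr. Qed.

HB.instance Definition _ := GRing.isZmodule.Build dep_prod daddA daddC dadd0 daddN.

Let null : {pred dep_prod} := fun x => `[< U [set i | x i = 0] >].

Let null_zmod : zmod_closed null.
Proof.
split=> [|x y /asboolP Ux /asboolP Uy]; apply/asboolP.
  by apply: filterS filterT => i _.
apply: filterS (filterI Ux Uy) => i [/= x0 y0].
by rewrite -[LHS]/(x i - y i) x0 y0 subr0.
Qed.

(* The subgroup of the families vanishing on a set of U: two families are
   equal in the ultraproduct iff they agree on a set of U. *)
Definition dnull : zmodClosed dep_prod :=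
  HB.pack null (GRing.isZmodClosed.Build dep_prod null null_zmod).

Definition ultraproduct : Type := Quotient.quot dnull.

HB.instance Definition _ := GRing.Zmodule.on ultraproduct.

(* Independent of the representatives, see [ultra_cycE]. *)
Definition ultra_cyc (x y z : ultraproduct) : Prop :=
  U [set i | cyc ((repr x : dep_prod) i) ((repr y : dep_prod) i) ((repr z : dep_prod) i)].

Definition ultra_pi (x : dep_prod) : ultraproduct := \pi_(Quotient.quot dnull)%qT x.

Lemma ultra_piE (x y : dep_prod) : ultra_pi x = ultra_pi y <-> U [set i | x i = y i].
Proof.
have -> : (ultra_pi x = ultra_pi y) <-> (x - y \in dnull).
  by rewrite (Quotient.idealrBE dnull x y); split=> /eqP.
split=> [/asboolP|] H; last apply/asboolP; apply: filterS H => i /= e.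
  by apply/eqP; rewrite -subr_eq0; apply/eqP; exact: e.
by rewrite -[LHS]/(x i - y i) e subrr.
Qed.

Lemma ultra_repr (x : ultraproduct) : ultra_pi (repr x) = x.
Proof. exact: reprK. Qed.

Lemma ultra_piK (x : dep_prod) : U [set i | (repr (ultra_pi x) : dep_prod) i = x i].
Proof. by apply/ultra_piE; rewrite ultra_repr. Qed.

Lemma ultra_cycE (x y z : dep_prod) :
  ultra_cyc (ultra_pi x) (ultra_pi y) (ultra_pi z) <->
  U [set i | cyc (x i) (y i) (z i)].
Proof.
have [Hx Hy Hz] : [/\ _, _ & _] := And3 (ultra_piK x) (ultra_piK y) (ultra_piK z).
by rewrite /ultra_cyc; split=> H'; apply: filterS (filterI Hx (filterI Hy (filterI Hz H'))) => i /= [-> [-> [->]]].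
Qed.

Lemma ultra_pi_add (x y : dep_prod) : ultra_pi (x + y) = ultra_pi x + ultra_pi y.
Proof. exact: (Quotient.pi_add dnull x y). Qed.

Let ultra_cyc_neq a b c : ultra_cyc a b c -> [/\ a <> b, b <> c & a <> c].
Proof.
rewrite -(ultra_repr a) -(ultra_repr b) -(ultra_repr c) => /ultra_cycE H.
by split=> /ultra_piE H'; have [i [/= /cyc_neq[]]] := filter_ex (filterI H H').
Qed.

Let ultra_cyc_rot a b c : ultra_cyc a b c -> ultra_cyc b c a.
Proof. by apply: filterS => i; apply: cyc_rot. Qed.

Let ultra_cyc_trans c x y z :
  ultra_cyc c x y -> ultra_cyc c y z -> ultra_cyc c x z.
Proof.
rewrite /ultra_cyc => H H'; apply: filterS (filterI H H') => i /= [].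
exact: cyc_trans.
Qed.

Let ultra_cyc_total c x y : x <> c -> y <> c -> x <> y ->
  ultra_cyc c x y \/ ultra_cyc c y x.
Proof.
have N (a b : ultraproduct) : a <> b ->
    U [set i | (repr a : dep_prod) i <> (repr b : dep_prod) i].
  move=> ab; case: (in_ultra_setVsetC [set i | (repr a : dep_prod) i = (repr b : dep_prod) i] UF) => //.
  by move=> /ultra_piE; rewrite !ultra_repr.
move=> /N xc /N yc /N xy.
case: (in_ultra_setVsetC [set i | cyc ((repr c : dep_prod) i) ((repr x : dep_prod) i) ((repr y : dep_prod) i)] UF).
  by left.
move=> H; right; apply: filterS (filterI H (filterI xc (filterI yc xy))).
by move=> i /= [n [h1 [h2 h3]]]; case: (cyc_total _ _ _ h1 h2 h3).
Qed.

Let ultra_cyc_add a b c u :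
  ultra_cyc a b c -> ultra_cyc (a + u) (b + u) (c + u).
Proof.
rewrite -(ultra_repr a) -(ultra_repr b) -(ultra_repr c) -(ultra_repr u).
move=> /ultra_cycE H; rewrite -!ultra_pi_add; apply/ultra_cycE.
by apply: filterS H => i; apply: cyc_add.
Qed.

HB.instance Definition _ := isCyclicallyOrdered.Build ultraproduct
  ultra_cyc_neq ultra_cyc_rot ultra_cyc_trans ultra_cyc_total ultra_cyc_add.

End Ultraproduct.

(** * The cyclically ordered groups Z/nZ *)

Definition posnat := {n : nat | (0 < n)%N}.

Section CyclicZn.
Variable n : nat.

Definition Zn_cyc (a b c : 'I_n.+1) : Prop :=
  [|| (a < b < c)%N, (b < c < a)%N | (c < a < b)%N].

Let Zn_cyc_neq a b c : Zn_cyc a b c -> [/\ a <> b, b <> c & a <> c].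
Proof. by rewrite /Zn_cyc => h; split=> e; move: h; rewrite e; lia. Qed.

Let Zn_cyc_rot a b c : Zn_cyc a b c -> Zn_cyc b c a.
Proof. by rewrite /Zn_cyc; lia. Qed.

Let Zn_cyc_trans c x y z : Zn_cyc c x y -> Zn_cyc c y z -> Zn_cyc c x z.
Proof. by rewrite /Zn_cyc; lia. Qed.

Let Zn_cyc_total c x y : x <> c -> y <> c -> x <> y ->
  Zn_cyc c x y \/ Zn_cyc c y x.
Proof.
move=> /eqP + /eqP + /eqP; rewrite -!val_eqE /= /Zn_cyc => *.
by apply/orP; lia.
Qed.

Let Zn_cyc_add (a b c u : 'I_n.+1) :
  Zn_cyc a b c -> Zn_cyc (a + u) (b + u) (c + u).
Proof.
have M (x : 'I_n.+1) : ((x + u)%R : nat) =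
    (if (x + u < n.+1)%N then x + u else x + u - n.+1)%N.
  rewrite /=; case: ltnP => h; first by rewrite modn_small.
  rewrite -[in LHS](subnK h) modnDr modn_small //.
  by have := ltn_ord x; have := ltn_ord u; lia.
rewrite /Zn_cyc !M; have := ltn_ord a; have := ltn_ord b; have := ltn_ord c.
have := ltn_ord u.
by case: (ltnP (a + u)%N); case: (ltnP (b + u)%N); case: (ltnP (c + u)%N); lia.
Qed.

HB.instance Definition _ := isCyclicallyOrdered.Build 'I_n.+1
  Zn_cyc_neq Zn_cyc_rot Zn_cyc_trans Zn_cyc_total Zn_cyc_add.

End CyclicZn.

(* [(val n).-1.+1] is [n] since [n > 0]; unlike ['Z_n], this is the trivial
   group for [n = 1]. *)
Definition Zn (n : posnat) : cogType := 'I_(val n).-1.+1.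

(** * Discreteness and c-regularity *)

Section Regular.
Variable G : cogType.

(* R(x_1, ..., x_m); only meaningful (and only used) for m >= 2. *)
Definition cycs (s : seq G) : Prop :=
  match s with
  | [:: x; y] => x <> y
  | _ => forall i j k : nat, (i < j < k)%N -> (k < size s)%N ->
           cyc (nth 0 s i) (nth 0 s j) (nth 0 s k)
  end.

Definition is_one (e : G) : Prop :=
  e <> 0 /\ forall x : G, x <> 0 -> x <> e -> cyc 0 e x.

Definition discrete : Prop :=
  (forall x : G, x = 0) \/ exists e, is_one e.

(* The element 1_G when [G] is discrete and nontrivial, [0] otherwise. *)
Definition oneG : G := xget 0 [set e | is_one e].

Definition c_n_regular (n : nat) : Prop :=
  forall s : n.-tuple G, cycs (0 :: s) ->
  let x1 := head 0 s in let xn := last 0 s in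
  exists x : G,
    [\/ x *+ n = x1, x *+ n = xn | cyc x1 (x *+ n) xn] /\
    cycs (rcons (mkseq (fun i => x *+ i) n) xn).

Definition c_regular : Prop := forall n : nat, (2 <= n)%N -> c_n_regular n.

(* D_{q,k}, where [q] is a prime power. *)
Definition D (q k : nat) : Prop :=
  exists x : G, cycs (mkseq (fun i => x *+ i) q) /\ x *+ q = oneG *+ k.

End Regular.

(** * Characteristic sequences and families *)

Definition primenat := {p : nat | prime p}.

Definition char_seq : Type := forall p : primenat, posnat -> 'I_(val p).

HB.instance Definition _ := gen_eqMixin char_seq.
HB.instance Definition _ := gen_choiceMixin char_seq.
HB.instance Definition _ := isPointed.Build char_seq
  (fun p _ => Ordinal (prime_gt0 (valP p))).

Definition posS (i : nat) : posnat := exist _ i.+1 (ltn0Sn i).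

(* phi_p(1) + phi_p(2) p + ... + phi_p(n) p^(n-1) *)
Definition digit_sum (phi : char_seq) (p : primenat) (n : posnat) : nat :=
  (\sum_(i < val n) phi p (posS i) * val p ^ i)%N.

Definition is_char_seq (G : cogType) (phi : char_seq) : Prop :=
  forall (p : primenat) (n : posnat) (k : nat), (k < val p ^ val n)%N ->
    D G (val p ^ val n) k <-> k = digit_sum phi p n.

(* N_{p^n, phi_p}; the subtraction does not truncate, as
   [digit_sum phi p n < p ^ n] and [m > 0]. *)
Definition char_set (phi : char_seq) (p : primenat) (n : posnat) : set posnat :=
  [set j | exists m : posnat,
     val j = (val p ^ val n * val m - digit_sum phi p n)%N].

Definition char_family (phi : char_seq) : set_system posnat :=
  [set N | exists p n, N = char_set phi p n].

(* [get P] is the element satisfying [P] when it exists and is unique. *)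
Definition family_of_group (G : cogType) : set_system posnat :=
  char_family (get [set phi | is_char_seq G phi]).

Definition family_of_ultrafilter (U : set_system posnat) : set_system posnat :=
  char_family (get [set phi | char_family phi `<=` U]).

Definition principal (T : Type) (U : set_system T) : Prop :=
  exists x : T, U = principal_filter x.

(* Main.v *)
From HB Require Import structures.
Require Import Defs.
From mathcomp Require Import all_boot all_order all_algebra all_classical.
From mathcomp Require Import zify.

(* A cyclically ordered group G unwinds to a linearly ordered group Gamma with a
   cofinal element z such that G = Gamma / z, the elements of G being represented
   by the interval [0, z[.  If G is c-regular and discrete, Gamma is a Z-group (a
   model of Presburger arithmetic), and for G = Z/n one may take Gamma = Z, z = n.
   Cooper's quantifier elimination, run as a back and forth, shows that the truth
   of a sentence in G depends only on the residue of z modulo some M, provided z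
   exceeds some standard bound.  As D_{p^n,k} says that p^n divides z + k, the
   characteristic sequence records exactly the residues of z; by Los's theorem
   the ultraproduct modulo U satisfies what holds in Z/n for U-many n, and the
   family defined by U records the residues of n. *)

Set Implicit Arguments.
Unset Strict Implicit.
Unset Printing Implicit Defensive.

Import Order.TTheory GRing.Theory Num.Theory.
Local Open Scope classical_set_scope.
Local Open Scope ring_scope.

(** * Discretely ordered abelian groups *)

(** Passing to the cover trades the cyclic order for a linear one at the price of a carry: the lift
    of a term of [G] is known only up to multiples of [z], so a term gives rise to a finite list of
    linear forms. The lists of atoms produced by the elimination depend on the formula alone, never
    on the groups; one modulus and one bound thus serve all groups at once, and [G] is compared
    directly with the factors Z/n, so that the ultraproduct itself is never unwound. The element [z]
    is either a standard multiple of the least positive element, and then the cover is a copy of the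
    integers, or it exceeds all of them; it is in the second case that c-regularity makes the cover
    a Z-group. The characteristic family speaks of prime powers, whereas the elimination involves
    arbitrary moduli: a Chinese remainder argument fills the gap. *)

(* A record rather than a structure, since a common subclass of
   [zmodType] and [orderType] would lack joins with the numeric hierarchy. *)
Record dogType := DogType {
  dog_zmod : zmodType;
  dog_lt : rel dog_zmod;
  dog_one : dog_zmod;
  dog_ltxx : irreflexive dog_lt;
  dog_lt_trans : transitive dog_lt;
  dog_lt_total : forall x y, x != y -> dog_lt x y || dog_lt y x;
  dog_ltD2 : forall u x y, dog_lt x y -> dog_lt (x + u) (y + u);
  dog_one_gt0 : dog_lt 0 dog_one;
  dog_one_min : forall x, dog_lt 0 x -> x = dog_one \/ dog_lt dog_one x
}.

Definition dog_sort (V : dogType) : Type := dog_zmod V.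
Coercion dog_sort : dogType >-> Sortclass.

HB.instance Definition _ (V : dogType) := GRing.Zmodule.on (dog_sort V).

Definition dog1 {V : dogType} : V := dog_one V.

HB.instance Definition _ (V : dogType) :=
  @Order.LtOrder.Build ring_display (dog_sort V)
    (fun x y => (x == y) || @dog_lt V x y) (@dog_lt V)
    (fun x y => if @dog_lt V x y then x else y)
    (fun x y => if @dog_lt V x y then y else x)
    (fun _ _ => erefl) (fun _ _ => erefl) (fun _ _ => erefl)
    (@dog_ltxx V) (@dog_lt_trans V) (@dog_lt_total V).

Section DogTheory.
Variable V : dogType.
Implicit Types x y u v : V.

Lemma dog1_gt0 : 0 < dog1 :> V.
Proof. exact: dog_one_gt0. Qed.

Lemma dog1_min x : 0 < x -> dog1 <= x.
Proof. by case/(@dog_one_min V) => [-> //|h]; exact: ltW. Qed.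

Lemma dltD2r u x y : (x + u < y + u) = (x < y).
Proof. by apply/idP/idP => [/(@dog_ltD2 V (- u))|/(@dog_ltD2 V u)]; rewrite ?addrK. Qed.

Lemma dltD2l u x y : (u + x < u + y) = (x < y).
Proof. by rewrite ![u + _]addrC dltD2r. Qed.

Lemma dleD2r u x y : (x + u <= y + u) = (x <= y).
Proof. by rewrite !leNgt dltD2r. Qed.

Lemma dleD2l u x y : (u + x <= u + y) = (x <= y).
Proof. by rewrite !leNgt dltD2l. Qed.

Lemma dltBr u x y : (x < y - u) = (x + u < y).
Proof. by rewrite -[LHS](dltD2r u) subrK. Qed.

Lemma dltBl u x y : (x - u < y) = (x < y + u).
Proof. by rewrite -[LHS](dltD2r u) subrK. Qed.

Lemma dsubr_gt0 x y : (0 < y - x) = (x < y).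
Proof. by rewrite dltBr add0r. Qed.

Lemma dltN2 x y : (- x < - y) = (y < x).
Proof. by rewrite -[LHS](dltD2r (x + y)) addKr addrCA addNr addr0. Qed.

Lemma doppr_lt0 x : (- x < 0) = (0 < x).
Proof. by rewrite -{1}oppr0 dltN2. Qed.

Lemma dltD x y u v : x < y -> u < v -> x + u < y + v.
Proof. by move=> h h'; apply: (@lt_trans _ _ (y + u)); rewrite ?dltD2r ?dltD2l. Qed.

Lemma dleD x y u v : x <= y -> u <= v -> x + u <= y + v.
Proof. by move=> h h'; apply: (@le_trans _ _ (y + u)); rewrite ?dleD2r ?dleD2l. Qed.

Lemma dlt_leD x y u v : x < y -> u <= v -> x + u < y + v.
Proof. by move=> h h'; apply: (@lt_le_trans _ _ (y + u)); rewrite ?dltD2r ?dleD2l. Qed.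

Lemma dlt_addone x y : (x < y + dog1) = (x <= y).
Proof.
apply/idP/idP => [h|h]; last first.
  by rewrite -[x]addr0; apply: (@le_lt_trans _ _ (y + 0)); rewrite ?dleD2r// dltD2l dog1_gt0.
rewrite leNgt; apply/negP; rewrite -dsubr_gt0 => /dog1_min.
by rewrite -(dleD2r y) subrK addrC leNgt h.
Qed.

Lemma dltMn n x y : x < y -> x *+ n.+1 < y *+ n.+1.
Proof. by move=> h; elim: n => // n IH; rewrite !(mulrS _ n.+1); exact: dltD. Qed.

Lemma dltMn2 n x y : (0 < n)%N -> (x *+ n < y *+ n) = (x < y).
Proof.
case: n => // n _; apply/idP/idP => [|/dltMn//]; apply: contraTT; rewrite -!leNgt.
by rewrite le_eqVlt => /orP[/eqP->//|/(dltMn n)/ltW].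
Qed.

Lemma dpmuln_gt0 n x : (0 < n)%N -> (0 < x *+ n) = (0 < x).
Proof. by move=> n0; rewrite -[RHS](dltMn2 _ _ n0) mul0rn. Qed.

Lemma dltMz x (j k : int) : 0 < x -> (x *~ j < x *~ k) = (j < k).
Proof.
move=> x0; have H (m n : int) : m < n -> x *~ m < x *~ n.
  move=> h; rewrite -dsubr_gt0 -mulrzBr.
  have : 0 < n - m by rewrite subr_gt0.
  by case: (n - m) => // i i0; rewrite -pmulrn dpmuln_gt0.
case: (ltgtP j k) => [/H//|/H h|->]; last by rewrite ltxx.
by apply/negbTE; rewrite -leNgt ltW.
Qed.

Lemma dleMz x (j k : int) : 0 < x -> (x *~ j <= x *~ k) = (j <= k).
Proof. by move=> x0; rewrite !leNgt dltMz. Qed.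

Lemma dMz_inj x (j k : int) : 0 < x -> x *~ j = x *~ k -> j = k.
Proof.
move=> x0 e; apply/eqP; rewrite eq_le -(dleMz _ _ x0) -(dleMz k j x0) e.
by rewrite lexx.
Qed.

Lemma le_dog1_muln x (n : nat) : 0 <= x -> x <= dog1 *+ n ->
  exists2 k : nat, (k <= n)%N & x = dog1 *+ k.
Proof.
move=> x0; elim: n => [|n IH] h.
  by exists 0%N => //; apply/eqP; rewrite eq_le x0 andbT.
move: h; rewrite le_eqVlt => /orP[/eqP->|]; first by exists n.+1.
by rewrite mulrSr dlt_addone => /IH [k kn ->]; exists k => //; exact: leq_trans kn _.
Qed.

(** Removing the integer quotient leaves [w] with [w *+ m.+1 = dog1 *~ r] and [0 <= r < m.+1], so
    [0 <= w < dog1], and discreteness gives [w = 0]. *)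
Lemma ddvd_dog1 (k : int) (m : nat) :
  (exists y : V, dog1 *~ k = y *+ m.+1) <-> (m.+1%:Z %| k)%Z.
Proof.
have o0 : 0 < dog1 :> V by exact: dog1_gt0.
split=> [[y e]|/dvdzP[q ->]]; last first.
  by exists (dog1 *~ q); rewrite mulrzA pmulrn.
have [q [r [rm ek]]] : exists q, exists r : int, (0 <= r < m.+1%:Z) /\ k = q * m.+1%:Z + r.
  exists (k %/ m.+1)%Z, (k %% m.+1)%Z; split; last exact: divz_eq.
  by rewrite modz_ge0// ltz_pmod.
have : dog1 *~ r = (y - dog1 *~ q) *+ m.+1 :> V.
  by rewrite mulrnBl -e pmulrn -mulrzA -mulrzBr ek addrAC subrr add0r.
move: (y - _) => w ew.
have w0 : 0 <= w.
  rewrite leNgt -(@dltMn2 m.+1)// mul0rn -ew -leNgt -(mulr0z dog1) dleMz//.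
  by case/andP: rm.
have w1 : w < dog1.
  by rewrite -(@dltMn2 m.+1)// -ew [X in _ < X]pmulrn dltMz//; case/andP: rm.
have w00 : w = 0.
  by apply/eqP; rewrite eq_le w0 andbT -dlt_addone add0r.
move: ew; rewrite w00 mul0rn -(mulr0z dog1) => /(dMz_inj o0) r0.
by rewrite ek r0 addr0 dvdz_mull.
Qed.

End DogTheory.

Lemma int_one_min (x : int) : 0 < x -> x = 1 \/ 1 < x.
Proof. by lia. Qed.

Lemma int_ltD2 (u x y : int) : x < y -> x + u < y + u.
Proof. by lia. Qed.

Lemma int_lt_total (x y : int) : x != y -> (x < y) || (y < x).
Proof. by lia. Qed.

Definition int_dog : dogType :=
  DogType (@ltxx _ int) (@lt_trans _ int) int_lt_total int_ltD2
    (isT : 0 < 1 :> int) int_one_min.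

(** * The ordered cover of a cyclically ordered group *)

Arguments cyc_neq {_} [_ _ _] _.
Arguments cyc_rot {_} [_ _ _] _.
Arguments cyc_trans {_} [_ _ _ _] _ _.
Arguments cyc_total {_} [_ _ _] _ _ _.
Arguments cyc_add {_} [_ _ _] _ _.

Section LinearOrder.
Variable G : cogType.
Implicit Types a b c x y u : G.

(** The circle cut open at [0], with [0] put first. *)
Definition glt x y : bool := `[< y <> 0 /\ (x = 0 \/ cyc 0 x y) >].

Lemma cyc_asym a b c : cyc a b c -> ~ cyc a c b.
Proof. by move=> h /(cyc_trans h) /cyc_neq[_]. Qed.

Lemma glt0x x : glt 0 x = (x != 0).
Proof. by apply/asboolP/idP => [[/eqP]//|/eqP]; split=> //; left. Qed.

Lemma gltx0 x : glt x 0 = false.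
Proof. by apply/asboolP => -[]. Qed.

Lemma gltE x y : x != 0 -> y != 0 -> glt x y <-> cyc 0 x y.
Proof.
move=> /eqP x0 /eqP y0; split=> [/asboolP[_ []]//|h].
by apply/asboolP; split=> //; right.
Qed.

Lemma glt_irr : irreflexive glt.
Proof.
move=> x; apply/negP => /asboolP[x0 [//|/cyc_neq[_ //]]].
Qed.

Lemma glt_trans : transitive glt.
Proof.
move=> y x z /asboolP[y0 h] /asboolP[z0 [//|yz]]; apply/asboolP; split=> //.
by case: h => [->|xy]; [left|right; exact: cyc_trans yz].
Qed.

Lemma glt_total x y : x != y -> glt x y || glt y x.
Proof.
move=> xy; case: (eqVneq x 0) => [x0|x0]; first by rewrite x0 glt0x -x0 eq_sym xy.
case: (eqVneq y 0) => [y0|y0]; first by rewrite y0 glt0x x0 orbT.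
by apply/orP; case: (cyc_total (elimN eqP x0) (elimN eqP y0) (elimN eqP xy)) => /gltE;
  [left|right]; auto.
Qed.

(** Read at [c]: transitivity gives [R(c, a, 0)], against [R(c, 0, a)]. *)
Lemma cyc0_incompatible a b c : cyc 0 a c -> cyc 0 c b -> cyc a b c -> False.
Proof.
move=> ac /cyc_rot cb /cyc_rot/cyc_rot h.
by apply: (cyc_asym (cyc_trans h cb)); do 2! apply: cyc_rot.
Qed.

Lemma cyc_sorted a b c : glt a b -> glt b c -> cyc a b c.
Proof.
move=> ab bc; have ac := glt_trans ab bc.
have b0 : b != 0 by apply: contraTneq ab => ->; rewrite gltx0.
have c0 : c != 0 by apply: contraTneq bc => ->; rewrite gltx0.
case: (eqVneq a 0) => [->|a0]; first exact/gltE.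
have N x y : glt x y -> y <> x by move=> + e; rewrite e glt_irr.
case: (@cyc_total _ a b c (N _ _ ab) (N _ _ ac)) => //; first by move=> e; exact: N bc _.
by move=> h; case: (@cyc0_incompatible a c b) => //; apply/gltE.
Qed.

Lemma cyc_gltE a b c : cyc a b c <->
  [|| glt a b && glt b c, glt b c && glt c a | glt c a && glt a b].
Proof.
split=> [h|]; last first.
  case/or3P=> /andP[h h']; first exact: cyc_sorted.
    by do 2! apply: cyc_rot; exact: cyc_sorted.
  by apply: cyc_rot; exact: cyc_sorted.
have [/eqP ab /eqP bc /eqP ac] := cyc_neq h.
have Z x y z : cyc x y z -> x = 0 -> glt x y && glt y z.
  move=> + x0; rewrite x0 => h'; have [/eqP y0 _ /eqP z0] := cyc_neq h'.
  by rewrite glt0x eq_sym y0; apply/gltE; rewrite // eq_sym.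
case: (eqVneq a 0) => [/(Z _ _ _ h)->//|a0].
case: (eqVneq b 0) => [/(Z _ _ _ (cyc_rot h))->|b0]; first by rewrite orbT.
case: (eqVneq c 0) => [/(Z _ _ _ (cyc_rot (cyc_rot h)))->|c0]; first by rewrite !orbT.
have N x y z : x != 0 -> y != 0 -> z != 0 -> cyc x y z -> glt x z -> glt z y -> False.
  by move=> x0 y0 z0 h' /gltE xz /gltE zy; apply: (cyc0_incompatible (xz _ _) (zy _ _) h').
have h' := cyc_rot h; have h'' := cyc_rot h'.
have := glt_total ab; have := glt_total bc; have := glt_total ac.
have := N _ _ _ a0 b0 c0 h; have := N _ _ _ b0 c0 a0 h'; have := N _ _ _ c0 a0 b0 h''.
case: (glt a b); case: (glt b a); case: (glt b c); case: (glt c b);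
  case: (glt a c); case: (glt c a) => //= n1 n2 n3 _ _ _;
  try solve [by case: (n1 isT isT)|by case: (n2 isT isT)|by case: (n3 isT isT)].
Qed.

(* Translation by [u] increases (carry, sum) lexicographically, where the carry
   is read off as [x + u < u]. *)
Lemma glt_addr u x y : glt x y ->
  ~~ glt (x + u) u && glt (y + u) u
  || (glt (x + u) u == glt (y + u) u) && glt (x + u) (y + u).
Proof.
move=> xy.
have y0 : y != 0 by apply: contraTneq xy => ->; rewrite gltx0.
case: (eqVneq x 0) => [->|x0].
  rewrite add0r glt_irr; have : y + u != u.
    by apply: contraNneq y0 => /eqP; rewrite -subr_eq0 addrK.
  by move/glt_total; case: (glt _ u).
move/gltE: xy => /(_ x0 y0)/(cyc_add u); rewrite add0r => /cyc_gltE.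
have A v w : glt v w -> glt w v = false.
  by move=> vw; apply/negP => /(glt_trans vw); rewrite glt_irr.
case/or3P => /andP[h h'].
- by rewrite (A _ _ h) (A _ _ (glt_trans h h')) h'.
- by rewrite h (glt_trans h h') h'.
- by rewrite h (A _ _ h').
Qed.

(** Otherwise [b < a + b < a]; then [-a < b < a < -b], and translating [R(0, -a, -b)] by [a + b]
    gives [R(a + b, b, a)], the wrong orientation. *)
Lemma carry_impl a b : glt (a + b) a -> glt (a + b) b.
Proof.
move=> h; case: (eqVneq b 0) => [b0|b0]; first by move: h; rewrite b0 addr0 glt_irr.
case: (eqVneq (a + b) 0) => [->|s0]; first by rewrite glt0x.
have a0 : a != 0 by apply: contraTneq h => ->; rewrite gltx0.
have : a + b != b by apply: contraNneq a0 => /eqP; rewrite -subr_eq0 addrK.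
case/glt_total/orP => // h'.
have h1 : cyc 0 (- a) b.
  move/gltE: h => /(_ s0 a0)/(cyc_add (- a)).
  by rewrite add0r subrr addrAC subrr add0r => /cyc_rot/cyc_rot.
have h2 : cyc 0 a (- b).
  move/gltE: (h') => /(_ b0 s0)/(cyc_add (- b)).
  by rewrite add0r subrr addrK => /cyc_rot.
have h3 : cyc 0 b a by apply/gltE => //; exact: glt_trans h.
have := cyc_add (a + b) (cyc_trans h1 (cyc_trans h3 h2)).
rewrite add0r addKr [a + b]addrC addKr => /cyc_rot/cyc_asym[]; rewrite addrC.
by apply: cyc_sorted.
Qed.

Lemma carryC a b : glt (a + b) a = glt (a + b) b.
Proof.
by apply/idP/idP => [/carry_impl//|]; rewrite addrC => /carry_impl.
Qed.

(** The 2-cocycle of [unwound] as an extension of [G] by the integers; as for addition modulo n, a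
    turn is recognised by the sum falling below a summand. *)
Definition carry a b : nat := glt (a + b) a.

Lemma carry_sym a b : carry a b = carry b a.
Proof. by rewrite /carry carryC addrC. Qed.

(** With [s = a + b + c], the outer carries compare [s] with [a + b] and with [a]. If both inner
    carries occur, or neither, transitivity makes these comparisons equivalent; if exactly one
    occurs, [glt_addr] applied to it decides both. *)
Lemma carryA a b c : (carry a b + carry (a + b)%R c = carry b c + carry a (b + c)%R)%N.
Proof.
have L v w s : glt v w = false -> glt s w -> glt s v.
  move=> vw sw; case: (eqVneq v w) => [->//|/glt_total]; rewrite vw /= => wv.
  exact: glt_trans wv.
rewrite /carry -addrA; set s := a + (b + c).
have r2 : glt s (a + b) = glt s c by rewrite /s addrA carryC.
have t2 : glt s a = glt s (b + c) by rewrite /s carryC.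
have p2 := carryC a b; have q2 := carryC b c.
have m1 : glt (a + b) b -> _ := @glt_addr c _ _.
have m2 : glt (b + c) b -> _ := @glt_addr a _ _.
rewrite -addrA -/s in m1; rewrite [b + c + a]addrC [b + a]addrC -/s in m2.
rewrite -p2 -q2 -r2 -t2 in m1.
case p : (glt (a + b) a) m1 m2 p2; case q : (glt (b + c) b) q2 => /= q2 m1 m2 p2.
- suff -> : glt s (a + b) = glt s a by [].
  apply/idP/idP => [h|]; first exact: glt_trans p.
  by rewrite t2 r2 => h; apply: glt_trans h _; rewrite -q2.
- by case/(_ isT): m1; rewrite andbF /= => /andP[/eqP -> ->].
- by case/(_ isT): m2; rewrite andbF /= => /andP[/eqP -> ->].
- suff -> : glt s (a + b) = glt s a by [].
  by apply/idP/idP => h; [rewrite t2; apply: L (esym q2) _; rewrite -r2|exact: L h].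
Qed.

End LinearOrder.

Section Unwound.
Variable G : cogType.

(* Rieger's unwound group: [(k, a)] is [a] lifted to the [k]-th turn. *)
Definition unwound : Type := (int * G)%type.

HB.instance Definition _ := Choice.copy unwound (int * G)%type.

Let uadd (u v : unwound) : unwound := (u.1 + v.1 + (carry u.2 v.2)%:Z, u.2 + v.2).
(** [- g + g] carries exactly when [g] is nonzero, hence the extra turn removed. *)
Let uopp (u : unwound) : unwound := (- u.1 - (u.2 != 0)%:Z, - u.2).

Let uaddA : associative uadd.
Proof.
move=> u v w; congr pair; rewrite /= ?addrA//.
by have := carryA u.2 v.2 w.2; lia.
Qed.

Let uaddC : commutative uadd.
Proof. by move=> u v; rewrite /uadd carry_sym [u.1 + _]addrC [u.2 + _]addrC. Qed.

Let uadd0 : left_id ((0, 0) : unwound) uadd.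
Proof. by case=> k g; rewrite /uadd /carry /= gltx0 !add0r addr0. Qed.

Let uaddN : left_inverse ((0, 0) : unwound) uopp uadd.
Proof.
case=> k g; rewrite /uadd /carry /= addNr glt0x oppr_eq0; congr pair.
by rewrite addrAC subrK addNr.
Qed.

HB.instance Definition _ := GRing.isZmodule.Build unwound uaddA uaddC uadd0 uaddN.

Lemma unwoundD (u v : unwound) :
  u + v = (u.1 + v.1 + (carry u.2 v.2)%:Z, u.2 + v.2) :> unwound.
Proof. by []. Qed.

Definition unwound_lt (u v : unwound) : bool :=
  (u.1 < v.1) || (u.1 == v.1) && glt u.2 v.2.

Let ult_irr : irreflexive unwound_lt.
Proof. by move=> u; rewrite /unwound_lt ltxx eqxx glt_irr. Qed.

Let ult_trans : transitive unwound_lt.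
Proof.
move=> v u w /orP[uv|/andP[/eqP uv uv']] /orP[vw|/andP[/eqP vw vw']]; rewrite /unwound_lt.
- by rewrite (lt_trans uv vw).
- by rewrite -vw uv.
- by rewrite uv vw.
- by rewrite uv vw eqxx (glt_trans uv' vw') orbT.
Qed.

Let ult_total (u v : unwound) : u != v -> unwound_lt u v || unwound_lt v u.
Proof.
rewrite -pair_eqE /= negb_and /unwound_lt.
by case: (ltgtP u.1 v.1) => //= _; exact: glt_total.
Qed.

Let ult_add (w u v : unwound) : unwound_lt u v -> unwound_lt (u + w) (v + w).
Proof.
rewrite /unwound_lt !unwoundD /carry /= !carryC.
case/orP => [h|/andP[/eqP -> /(@glt_addr _ w.2)]]; last first.
  by case: (glt (u.2 + w.2) _); case: (glt (v.2 + w.2) _) => //= h; apply/orP; lia.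
case e: (glt (u.2 + w.2) _); case e': (glt (v.2 + w.2) _); try by apply/orP; left; lia.
(* Only the left sum carries, so the turns may become equal; but then
   [u.2 + w.2 < w.2 <= v.2 + w.2]. *)
have -> : glt (u.2 + w.2) (v.2 + w.2).
  case: (eqVneq (v.2 + w.2) w.2) => [->//|/glt_total]; rewrite e' /=.
  exact: glt_trans e.
by apply/orP; lia.
Qed.

Variables (e : G) (he : is_one e).

Let ult_one_gt0 : unwound_lt 0 ((0, e) : unwound).
Proof. by rewrite /unwound_lt /= glt0x; apply/eqP; case: he. Qed.

Let ult_one_min (u : unwound) : unwound_lt 0 u ->
  u = (0, e) \/ unwound_lt ((0, e) : unwound) u.
Proof.
case: he => e0 h; case: u => k g; rewrite /unwound_lt /= glt0x.
case/orP => [->|/andP[/eqP<- /eqP g0]]; first by right.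
have [->|ge] := pselect (g = e); [by left|right].
by apply/gltE; try exact/eqP; exact: h.
Qed.

Definition unwound_dog : dogType :=
  DogType ult_irr ult_trans ult_total ult_add ult_one_gt0 ult_one_min.

End Unwound.

(** * Unwindings *)

(* [G] is identified with the interval [[0, uz[] of an ordered group, with
   addition modulo [uz]. *)
Record unwinding (G : cogType) := Unwinding {
  ugrp :> dogType;
  uz : ugrp;
  urep : G -> ugrp;
  urep_ge0 : forall a, 0 <= urep a;
  urep_lt : forall a, urep a < uz;
  urep_inj : injective urep;
  urep_dec : forall x, exists a (k : int), x = urep a + uz *~ k;
  urep0 : urep 0 = 0;
  urepD : forall a b, urep (a + b) = urep a + urep b \/
    urep (a + b) = urep a + urep b - uz;
  urep_cyc : forall a b c, cyc a b c <->
    [|| (urep a < urep b) && (urep b < urep c),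
        (urep b < urep c) && (urep c < urep a)
      | (urep c < urep a) && (urep a < urep b)]
}.

(** Divisibility of [V] modulo the subgroup generated by [dog1]; the remainder [r] gets its bound in
    [z_group_mod]. *)
Definition z_group (V : dogType) := forall (n : nat) (x : V),
  exists y (r : int), x = y *+ n.+1 + dog1 *~ r.

Section UnwoundUnwinding.
Variables (G : cogType) (e : G) (he : is_one e).

Let V := unwound_dog he.
Let z : V := (1, 0) : unwound G.
Let rep (a : G) : V := (0, a) : unwound G.

Let rep_ge0 a : 0 <= rep a.
Proof.
rewrite le_eqVlt; case: (eqVneq a 0) => [->|a0]; first by rewrite eqxx.
by apply/orP; right; rewrite -[_ < _]/(glt 0 a) glt0x.
Qed.

Let rep_lt a : rep a < z.
Proof. by []. Qed.

Let rep_inj : injective rep.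
Proof. by move=> a b []. Qed.

Let zM (k : int) : z *~ k = (k, 0) :> unwound G.
Proof.
have H (n : nat) : z *+ n = (n%:Z, 0) :> unwound G.
  elim: n => // n IH; rewrite mulrS IH unwoundD /= /carry gltx0 !addr0.
  by congr pair; lia.
case: k => n; first exact: H.
rewrite NegzE mulrNz -pmulrn; apply/eqP; rewrite eq_sym -addr_eq0; apply/eqP.
by rewrite H unwoundD /= /carry gltx0 !addr0 addNr.
Qed.

Let rep_dec x : exists a (k : int), x = rep a + z *~ k.
Proof.
case: x => k a; exists a, k; rewrite zM unwoundD /= add0r /carry !addr0.
by rewrite glt_irr addr0.
Qed.

Let repD a b : rep (a + b) = rep a + rep b \/ rep (a + b) = rep a + rep b - z.
Proof.
case h : (carry a b) => [|m]; [left|right].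
  by rewrite unwoundD /= h.
apply/eqP; rewrite eq_sym subr_eq; apply/eqP.
rewrite !unwoundD /= h /carry !addr0 glt_irr; congr pair.
by move: h; rewrite /carry; case: glt => // -[<-].
Qed.

Definition unwound_unwinding : unwinding G :=
  @Unwinding G V z rep rep_ge0 rep_lt rep_inj rep_dec erefl repD
    (@cyc_gltE G).

End UnwoundUnwinding.

Lemma int_dog_ltE (x y : int) : ((x : int_dog) < (y : int_dog)) = (x < y).
Proof. by []. Qed.

Lemma int_dog_leE (x y : int) : ((x : int_dog) <= (y : int_dog)) = (x <= y).
Proof. by rewrite !leNgt int_dog_ltE. Qed.

Lemma int_dog_zgroup : z_group int_dog.
Proof.
move=> n x; exists (x %/ n.+1)%Z, (x %% n.+1)%Z.
have e : x = (x %/ n.+1)%Z *+ n.+1 + 1 *~ (x %% n.+1)%Z :> int.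
  by rewrite intz pmulrn -mulrzr intz; exact: divz_eq.
exact: e.
Qed.

Section IntUnwinding.
Variable n : nat.

Let rep (a : 'I_n.+1) : int_dog := a%:Z.

Let rep_ge0 a : 0 <= rep a.
Proof. by rewrite int_dog_leE. Qed.

Let rep_lt a : rep a < (n.+1%:Z : int_dog).
Proof. by rewrite int_dog_ltE ltz_nat. Qed.

Let rep_inj : injective rep.
Proof. by move=> a b [] /val_inj. Qed.

Let rep_dec x : exists a (k : int), x = rep a + (n.+1%:Z : int_dog) *~ k.
Proof.
have h0 := @modz_ge0 x n.+1 isT.
have h : (`|(x %% n.+1)%Z| < n.+1)%N by have := @ltz_pmod x n.+1 isT; lia.
exists (Ordinal h), (x %/ n.+1)%Z; rewrite /rep /=.
have e : x = `|(x %% n.+1)%Z|%N%:Z + n.+1%:Z *~ (x %/ n.+1)%Z :> int.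
  by rewrite gez0_abs// -mulrzl intz addrC; exact: divz_eq.
exact: e.
Qed.

Let repD a b : rep (a + b) = rep a + rep b \/
  rep (a + b) = rep a + rep b - (n.+1%:Z : int_dog).
Proof.
have := ltn_ord a; have := ltn_ord b; rewrite /rep /= => hb ha.
case: (ltnP (a + b) n.+1) => h; [left|right]; first by rewrite modn_small.
rewrite -{1}(subnK h) modnDr modn_small; last by lia.
by rewrite -[LHS]/((a + b - n.+1)%N%:Z) -subzn.
Qed.

Let rep_cyc (a b c : 'I_n.+1) : cyc a b c <->
    [|| (rep a < rep b) && (rep b < rep c),
        (rep b < rep c) && (rep c < rep a)
      | (rep c < rep a) && (rep a < rep b)].
Proof. by rewrite !int_dog_ltE !ltz_nat. Qed.

Definition int_unwinding : unwinding 'I_n.+1 :=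
  @Unwinding _ int_dog (n.+1%:Z : int_dog) rep rep_ge0 rep_lt rep_inj rep_dec erefl repD
    rep_cyc.

End IntUnwinding.

Section TrivialUnwinding.
Variables (G : cogType) (G0 : forall x : G, x = 0).

Let rep (a : G) : int_dog := 0.

Let rep_lt a : rep a < (dog1 : int_dog).
Proof. exact: dog1_gt0. Qed.

Let rep_inj : injective rep.
Proof. by move=> a b _; rewrite (G0 a) (G0 b). Qed.

Let rep_dec x : exists (a : G) (k : int), x = rep a + (dog1 : int_dog) *~ k.
Proof. by exists 0, x; have e : x = 0 + 1 *~ x by rewrite intz add0r. Qed.

Let rep_cyc (a b c : G) : cyc a b c <->
    [|| (rep a < rep b) && (rep b < rep c),
        (rep b < rep c) && (rep c < rep a)
      | (rep c < rep a) && (rep a < rep b)].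
Proof. by split=> // /cyc_neq[]; rewrite (G0 a) (G0 b). Qed.

(** The trivial group has no least nonzero element, so [unwound_dog] does not apply to it; it is the
    integers modulo [1]. *)
Definition trivial_unwinding : unwinding G :=
  @Unwinding _ int_dog dog1 rep (fun _ => lexx _) rep_lt rep_inj rep_dec
    erefl (fun _ _ => or_introl erefl) rep_cyc.

End TrivialUnwinding.

Section UnwindingTheory.
Variables (G : cogType) (W : unwinding G).
Implicit Types (a b : G) (x y : W).
Local Notation z := (uz W).
Local Notation rep := (@urep G W).

Lemma uz_gt0 : 0 < z.
Proof. exact: le_lt_trans (urep_ge0 W 0) (urep_lt W 0). Qed.

Lemma urep_uniq x y (k : int) : 0 <= x -> x < z -> 0 <= y -> y < z ->
  x = y + z *~ k -> x = y.
Proof.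
move=> x0 xz y0 yz e; suff k0 : k = 0 by rewrite e k0 addr0.
have z0 := uz_gt0.
have : z *~ k < z *~ 1.
  apply: le_lt_trans xz; rewrite e -{1}[z *~ k]add0r dleD2r//.
have : z *~ (-1) < z *~ k.
  by rewrite mulrNz mulr1z -(dltD2l y) -e; apply: lt_le_trans x0; rewrite dltBl add0r.
rewrite !dltMz//; lia.
Qed.

Lemma urep_surj x : 0 <= x -> x < z -> exists a, rep a = x.
Proof.
move=> x0 xz; have [a [k e]] := urep_dec x.
by exists a; apply/esym/(urep_uniq x0 xz (urep_ge0 W a) (urep_lt W a) e).
Qed.

Lemma urepN a : rep (- a) = - rep a \/ rep (- a) = z - rep a.
Proof.
case: (urepD W (- a) a); rewrite addNr urep0 => e; [left|right].
  by apply/eqP; rewrite -addr_eq0 -e.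
by apply/eqP; rewrite eq_sym subr_eq eq_sym -subr_eq0 -e.
Qed.

Lemma urep_gt0 a : (0 < rep a) = (a != 0).
Proof.
by rewrite lt_neqAle urep_ge0 andbT eq_sym -{1}(urep0 W) (inj_eq (@urep_inj _ W)).
Qed.

Lemma cyc0_urep a b : cyc 0 a b <-> (0 < rep a) && (rep a < rep b).
Proof.
rewrite (urep_cyc W) (urep0 W).
have N c : rep c < 0 = false by apply/negbTE; rewrite -leNgt urep_ge0.
by rewrite !N andbF /= orbF.
Qed.

End UnwindingTheory.

(** * Back and forth between discretely ordered groups *)

Definition ddvd (V : dogType) (m : nat) (v : V) : Prop := exists y, v = y *+ m.

Lemma ddvdD (V : dogType) m (u v : V) : ddvd m u -> ddvd m (u + v) <-> ddvd m v.
Proof.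
move=> [y ->]; split=> [[w e]|[w ->]]; last by exists (y + w); rewrite mulrnDl.
by exists (w - y); rewrite mulrnBl -e addrAC subrr add0r.
Qed.

Lemma z_group_mod (V : dogType) (m : nat) (x : V) : z_group V -> (0 < m)%N ->
  exists w (r : nat), (r < m)%N /\ x = w *+ m + dog1 *+ r.
Proof.
case: m => // m zV _; have [y [r ->]] := zV m x.
exists (y + dog1 *~ (r %/ m.+1)%Z), `|(r %% m.+1)%Z|%N.
have h0 := @modz_ge0 r m.+1 isT; have h1 := @ltz_pmod r m.+1 isT.
split; first by lia.
rewrite {1}(divz_eq r m.+1) mulrzDr mulrnDl -addrA; congr (_ + (_ + _)).
  by rewrite mulrzA pmulrn.
by rewrite pmulrn gez0_abs.
Qed.

(* [((c, d), f)] stands for [c * dog1 + d * z + \sum_i f i * e i]. *)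
Definition linform (n : nat) : Type := (int * int * {ffun 'I_n -> int})%type.
HB.instance Definition _ n := GRing.Zmodule.copy (linform n)
  (int * int * {ffun 'I_n -> int})%type.

Section Forms.
Variables (V : dogType) (z : V).

Definition fval n (e : 'I_n -> V) (f : linform n) : V :=
  locked (dog1 *~ f.1.1 + z *~ f.1.2 + \sum_i e i *~ f.2 i).

Lemma fval_additive n (e : 'I_n -> V) : zmod_morphism (fval e).
Proof.
move=> f g; rewrite /fval -!lock /= !mulrzBr !opprD [in RHS]addrACA; congr (_ + _).
  by rewrite addrACA.
by rewrite -sumrB; apply: eq_bigr => i _; rewrite !ffunE mulrzBr.
Qed.

HB.instance Definition _ n (e : 'I_n -> V) :=
  GRing.isZmodMorphism.Build (linform n) V (fval e) (fval_additive e).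

Definition lconst n (c : int) : linform n := (c, 0, 0).
Definition luz n : linform n := (0, 1, 0).
Definition lvar n (i : 'I_n) : linform n := (0, 0, [ffun j => (j == i)%:Z]).

Lemma fvalD n (e : 'I_n -> V) : {morph fval e : f g / f + g}.
Proof. exact: raddfD. Qed.

Lemma fvalN n (e : 'I_n -> V) : {morph fval e : f / - f}.
Proof. exact: raddfN. Qed.

Lemma fvalMz n (e : 'I_n -> V) k : {morph fval e : f / f *~ k}.
Proof. exact: raddfMz. Qed.

Lemma fval_const n e c : fval e (lconst n c) = dog1 *~ c.
Proof. by rewrite /fval -!lock /= mulr0z addr0 big1 ?addr0// => i _; rewrite ffunE. Qed.

Lemma fval_uz n e : fval e (luz n) = z.
Proof. by rewrite /fval -!lock /= add0r big1 ?addr0// => i _; rewrite ffunE. Qed.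

Lemma fval_var n (e : 'I_n -> V) i : fval e (lvar i) = e i.
Proof.
rewrite /fval -!lock /= !mulr0z !add0r (bigD1 i)//= ffunE eqxx big1 ?addr0// => j ji.
by rewrite ffunE (negbTE ji).
Qed.

Definition econs n (x : V) (e : 'I_n -> V) : 'I_n.+1 -> V :=
  fun i => oapp e x (unlift ord0 i).

Definition fhead n (f : linform n.+1) : int := f.2 ord0.
Definition ftail n (f : linform n.+1) : linform n := (f.1, [ffun i => f.2 (lift ord0 i)]).

Lemma fval_cons n (x : V) (e : 'I_n -> V) f :
  fval (econs x e) f = x *~ fhead f + fval e (ftail f).
Proof.
rewrite /fval -!lock big_ord_recl /econs unlift_none /= addrCA; congr (_ + (_ + _)).
by apply: eq_bigr => i _; rewrite liftK ffunE.
Qed.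

(* [(None, f)] is the atom [0 < f] and [(Some m, f)] is [m.+1 %| f]. *)
Definition atom n : Type := (option nat * linform n)%type.
HB.instance Definition _ n := Equality.copy (atom n) (option nat * linform n)%type.

Definition holds n (e : 'I_n -> V) (a : atom n) : Prop :=
  if a.1 is Some m then ddvd m.+1 (fval e a.2) else 0 < fval e a.2.

End Forms.

(** The quantifier-free information that [L] can see. As [L] mentions neither group, it can be fixed
    before the groups are. *)
Definition agree n (L : seq (atom n)) (V : dogType) (z : V) (e : 'I_n -> V)
    (V' : dogType) (z' : V') (e' : 'I_n -> V') : Prop :=
  forall a, a \in L -> holds z e a <-> holds z' e' a.

Lemma agree_sym n (L : seq (atom n)) V z e V' z' e' :
  @agree n L V z e V' z' e' -> agree L z' e' z e.
Proof. by move=> h a /h; apply: iff_sym. Qed.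

Lemma agreeW n (L L' : seq (atom n)) V z e V' z' e' : {subset L' <= L} ->
  @agree n L V z e V' z' e' -> agree L' z e z' e'.
Proof. by move=> s h a /s/h. Qed.

(** * Elimination of one quantifier *)

Lemma ex_max_seq (V : dogType) (T : eqType) (f : T -> V) (P : pred T) (s : seq T) t0 :
  t0 \in s -> P t0 ->
  exists t, [/\ t \in s, P t & forall u, u \in s -> P u -> f u <= f t].
Proof.
elim: s t0 => // a s IH t0; rewrite in_cons => h Pt0.
have [/hasP[t1 t1s Pt1]|/hasPn N] := boolP (has P s); last first.
  case/orP: h => [/eqP e|/N]; last by rewrite Pt0.
  rewrite e in Pt0; exists a; split => //; first exact: mem_head.
  by move=> u; rewrite in_cons => /orP[/eqP -> //|/N/negbTE ->].
have [t [ts Pt tm]] := IH _ t1s Pt1.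
have [/andP[Pa ta]|na] := boolP (P a && (f t <= f a)).
  exists a; split => //; first exact: mem_head.
  by move=> u; rewrite in_cons => /orP[/eqP -> //|us /(tm _ us)]; move/le_trans; apply.
exists t; split => //; first by rewrite in_cons ts orbT.
move=> u; rewrite in_cons => /orP[/eqP -> Pa|]; last exact: tm.
by move: na; rewrite Pa /= -ltNge => /ltW.
Qed.

(* Cooper's argument: [x *+ A] is moved down, modulo [A * M], to just above
   the largest of the values of [T] below it. *)
Lemma cut_step n (T : seq (linform n)) (A M : nat) : (0 < A)%N -> (0 < M)%N ->
  exists L : seq (atom n), forall V z e V' z' e', z_group V ->
  @agree n L V z e V' z' e' -> forall x : V, 0 <= x ->
  exists (x' : V') (w : V) (w' : V') (r : nat),
    [/\ (r < M)%N, x = w *+ M + dog1 *+ r, x' = w' *+ M + dog1 *+ r &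
      forall t, t \in T -> (fval z e t < x *+ A) = (fval z' e' t < x' *+ A)].
Proof.
(* Controlling [x] modulo [M] amounts to controlling [x *+ A] modulo [N]. *)
move=> A0 M0; set N := (A * M)%N; have N0 : (0 < N)%N by rewrite muln_gt0 A0.
(* As [x] is nonnegative, the constant [-1] guarantees a cut below [x *+ A]. *)
pose T0 := lconst n (-1) :: T.
(* [L1] compares the gaps in [T0] with every [r < N]; [L2] records residues modulo [N], written
   [N.-1] since [Some m] has modulus [m.+1]. *)
pose L1 : seq (atom n) := [seq (None, p.1 - p.2 - lconst n (Posz r)) |
  p <- [seq (u, t) | u <- T0, t <- T0], r <- iota 0 N].
pose L2 : seq (atom n) := [seq (Some N.-1, t + lconst n (Posz p.1.+1 - Posz (A * p.2))) |
  t <- T0, p <- [seq (r, q) | r <- iota 0 N, q <- iota 0 M]].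
exists (L1 ++ L2) => V z e V' z' e' zV ag x x0.
have [w [q [qM ex]]] := z_group_mod x zV M0.
have b0 : fval z e (lconst n (-1)) < x *+ A.
  rewrite fval_const; apply: (@lt_le_trans _ _ 0); first by rewrite mulrNz doppr_lt0 dog1_gt0.
  by rewrite leNgt -[X in _ < X](mul0rn _ A) dltMn2// -leNgt.
have [t [tT ty tmax]] := ex_max_seq (fval z e) (P := fun t => fval z e t < x *+ A)
   (mem_head _ T : _ \in T0) b0.
have [v [r [rN ev]]] := z_group_mod (x *+ A - fval z e t - dog1) zV N0.
have v0 : 0 <= v.
  rewrite leNgt; apply/negP => v0.
  have : v *+ N + dog1 *+ r < 0.
    apply: (@lt_le_trans _ _ ((v + dog1) *+ N)); last first.
      by rewrite leNgt -{1}(mul0rn _ N) dltMn2// -leNgt -dlt_addone dltD2r.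
    by rewrite mulrnDl dltD2l !pmulrn dltMz// dog1_gt0.
  by rewrite -ev dltBl add0r dltBl addrC dlt_addone leNgt ty.
(* [x *+ A] exceeds the largest cut [t] below it by [1 + v * N + r]; in [V'] the part [v * N] will
   be dropped. *)
have ey : x *+ A = fval z e t + dog1 + (v *+ N + dog1 *+ r).
  by rewrite -ev -[_ - _ - _]addrA -opprD [RHS]addrC subrK.
have yge : fval z e t + dog1 *+ r < x *+ A.
  rewrite ey -addrA  dltD2l addrA -[X in X < _]add0r dltD2r -[X in X < _]addr0.
  by apply: dlt_leD; [exact: dog1_gt0|rewrite leNgt -{1}(mul0rn _ N) dltMn2// -leNgt].
(* [t + r + 1] is congruent to [A * q] modulo [N = A * M]; carried over to [V'], this supplies [x']
   with residue [q] modulo [M] and [x' *+ A = t + r + 1]. *)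
have hd : ddvd N (fval z e t + dog1 *~ (Posz r.+1 - Posz (A * q))).
  exists (w - v); rewrite mulrnBl; apply/eqP; rewrite eq_sym subr_eq.
  have -> : w *+ N = x *+ A - dog1 *+ (A * q).
    by rewrite ex mulrnDl -!mulrnA [(q * A)%N]mulnC addrK mulnC.
  rewrite ey mulrzBr -!pmulrn mulrS; apply/eqP.
  by rewrite !addrA [RHS]addrAC; congr (_ + _); rewrite addrAC.
have : ddvd N (fval z' e' t + dog1 *~ (Posz r.+1 - Posz (A * q))).
  have : (Some N.-1, t + lconst n (Posz r.+1 - Posz (A * q))) \in L1 ++ L2.
    rewrite mem_cat; apply/orP; right; apply/allpairsP.
    exists (t, (r, q)); split=> //; apply/allpairsP; exists (r, q).
    by rewrite !mem_iota /= !add0n.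
  case/ag => + _; rewrite /holds /= prednK// !fvalD !fval_const.
  exact.
case=> w' ew'.
pose x' := w' *+ M + dog1 *+ q.
have ex' : x' *+ A = fval z' e' t + dog1 *+ r.+1.
  rewrite /x' mulrnDl -!mulrnA [(M * A)%N]mulnC -ew' mulrzBr -!pmulrn [(q * A)%N]mulnC.
  by rewrite addrA subrK.
exists x', w, w', q; split=> // u uT.
have P : (0 < fval z e (u - t - lconst n (Posz r))) = (0 < fval z' e' (u - t - lconst n (Posz r))).
  have : (None, u - t - lconst n (Posz r)) \in L1 ++ L2.
    rewrite mem_cat; apply/orP; left; apply/allpairsP.
    have uT0 : u \in T0 by rewrite in_cons uT orbT.
    exists ((u, t), r); split; rewrite ?mem_iota//.
    by apply/allpairsP; exists (u, t).
  by case/ag => h h'; apply/idP/idP.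
(* No value of [T] lies strictly between [t] and [x *+ A], so both sides say [t + r < u], which is
   an atom of [L1]. *)
apply: negb_inj; rewrite -!leNgt.
have -> : (x' *+ A <= fval z' e' u) = (0 < fval z' e' (u - t - lconst n (Posz r))).
  rewrite ex' mulrSr addrA -dlt_addone dltD2r !(fvalD, fvalN) fval_const -addrA.
  by rewrite -opprD dsubr_gt0 pmulrn.
rewrite -P !(fvalD, fvalN) fval_const -addrA -opprD dsubr_gt0 -pmulrn.
apply/idP/idP => [h|]; first exact: lt_le_trans h.
apply: contraTT; rewrite -leNgt -ltNge => h.
apply: le_trans (tmax _ _ h) _; rewrite ?in_cons ?uT ?orbT//.
by rewrite -[X in X <= _]addr0 dleD2l -(mulr0n dog1) !pmulrn dleMz// dog1_gt0.
Qed.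

(** The default [1] keeps the product over a list positive. *)
Definition acoef n (a : atom n.+1) : nat :=
  let h := fhead a.2 in if h == 0 then 1%N else `|h|%N.

Definition amod n (a : atom n) : nat := if a.1 is Some m then m.+1 else 1%N.

Lemma dvdn_prod_seq (T : eqType) (F : T -> nat) (s : seq T) x : x \in s ->
  (F x %| \prod_(y <- s) F y)%N.
Proof.
elim: s => // y s IH; rewrite in_cons big_cons => /orP[/eqP ->|/IH h].
  exact: dvdn_mulr.
exact: dvdn_mull.
Qed.

(* For an atom [0 < h x + t], the bound to which [x *+ A] is compared. *)
Definition acut n (A : nat) (a : atom n.+1) : linform n :=
  let h := fhead a.2 in
  let t := ftail a.2 *~ Posz (A %/ acoef a) in
  if 0 < h then - t else t - lconst n 1.

(** Multiplying by [A %/ acoef a] gives [x] the coefficient [A] or [-A]. In the second case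
    discreteness rewrites [x *+ A < t] as the negation of [t - 1 < x *+ A], so that all inequalities
    become cuts of the one shape treated by [cut_step]. *)
Lemma holds_cut (V : dogType) (z : V) n (e : 'I_n -> V) A f (x : V) :
  let a := (None, f) : atom n.+1 in
  (0 < A)%N -> (acoef a %| A)%N -> fhead f != 0 ->
  (0 < fval z (econs x e) f) =
  (if 0 < fhead f then fval z e (acut A a) < x *+ A
   else ~~ (fval z e (acut A a) < x *+ A)).
Proof.
move=> a A0 dA h0; rewrite fval_cons /acut /=.
set b := (A %/ acoef a)%N.
have eA : A = (acoef a * b)%N by rewrite /b mulnC divnK.
have b0 : (0 < b)%N by move: A0; rewrite eA muln_gt0 => /andP[].
rewrite -(dpmuln_gt0 _ b0) mulrnDl.
have ex : (x *~ fhead f) *+ b = if 0 < fhead f then x *+ A else - (x *+ A).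
  rewrite eA /acoef /= (negbTE h0) mulrnA; case: (ltrP 0 (fhead f)) => h.
    by rewrite -[in LHS](gtz0_abs h).
  by rewrite -[in LHS](opprK (fhead f)) -(lez0_abs h) mulrNz mulNrn.
rewrite ex; case: ifP => h.
  by rewrite fvalN fvalMz -pmulrn -[in RHS]dsubr_gt0 opprK.
rewrite fvalD fvalN fval_const fvalMz -pmulrn mulr1z -leNgt -dlt_addone subrK.
by rewrite addrC dsubr_gt0.
Qed.

(** Divisibility atoms see [x] modulo [M] only, inequalities see only which cuts lie below [x *+ A];
    [cut_step] preserves both. Nonnegative [x] suffice because quantified elements of [G] are
    represented in [[0, z[]. *)
Lemma back_forth n (L : seq (atom n.+1)) :
  exists L' : seq (atom n), forall V z e V' z' e', z_group V ->
  @agree n L' V z e V' z' e' -> forall x : V, 0 <= x ->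
  exists x' : V', agree L z (econs x e) z' (econs x' e').
Proof.
pose A := (\prod_(a <- L) acoef a)%N; pose M := (\prod_(a <- L) amod a)%N.
have A0 : (0 < A)%N.
  by apply: prodn_gt0 => a; rewrite /acoef; case: eqP => // /eqP; rewrite absz_gt0.
have M0 : (0 < M)%N by apply: prodn_gt0 => -[[]].
have [L1 H] := cut_step [seq acut A a | a <- L] A0 M0.
(* The added atoms put the constant [r] for [x], for each residue [r]; with [r = 0] they also cover
   the inequalities in which [x] has coefficient [0]. *)
exists (L1 ++ [seq (a.1, ftail a.2 + lconst n (fhead a.2 * Posz r)) | a <- L, r <- iota 0 M]).
move=> V z e V' z' e' zV ag x x0.
have ag1 : agree L1 z e z' e' by apply: agreeW ag => a; rewrite mem_cat => ->.
have [x' [w [w' [r [rM ex ex' Hc]]]]] := H _ _ _ _ _ _ zV ag1 _ x0.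
exists x' => a aL.
have ag2 q : (q < M)%N -> holds z e (a.1, ftail a.2 + lconst n (fhead a.2 * Posz q)) <->
      holds z' e' (a.1, ftail a.2 + lconst n (fhead a.2 * Posz q)).
  move=> qM; apply: ag; rewrite mem_cat; apply/orP; right.
  by apply/allpairsP; exists (a, q); rewrite mem_iota.
have dA : (acoef a %| A)%N := dvdn_prod_seq (@acoef n) aL.
have dM : (amod a %| M)%N := dvdn_prod_seq (@amod n.+1) aL.
have Ha := Hc _ (map_f (acut A) aL).
case: a aL ag2 dA dM Ha {Hc} => [[m|] f] aL ag2 dA dM Ha; rewrite /holds /=.
  have E (U : dogType) (zU : U) (eU : 'I_n -> U) y v : y = v *+ M + dog1 *+ r ->
      ddvd m.+1 (fval zU (econs y eU) f) <->
      ddvd m.+1 (fval zU eU (ftail f + lconst n (fhead f * Posz r))).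
    move=> ->; rewrite fval_cons fvalD fval_const mulrzDl -addrA; apply: iff_trans.
      apply: ddvdD; exists (v *~ fhead f *+ (M %/ m.+1)%N).
      by rewrite -mulrnA divnK// !pmulrn mulrzAC.
    by rewrite addrC pmulrn mulrC mulrzA.
  apply: iff_trans (E _ _ _ _ _ ex) _; apply: iff_trans (iff_sym (E _ _ _ _ _ ex')).
  exact: ag2.
case: (eqVneq (fhead f) 0) => [h0|h0]; last by rewrite !(holds_cut _ _ _ A0 dA h0) Ha.
have := ag2 _ M0; rewrite /holds /= !fval_cons h0 !mulr0z !add0r mul0r.
by rewrite !fvalD !fval_const !mulr0z !addr0.
Qed.

(** * First-order formulas and unwindings *)

Definition uenv (G : cogType) (W : unwinding G) n (e : n.-tuple G) : 'I_n -> W :=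
  fun i => urep W (tnth e i).

Definition uagree n (L : seq (atom n)) (G : cogType) (W : unwinding G) (e : n.-tuple G)
    (G' : cogType) (W' : unwinding G') (e' : n.-tuple G') : Prop :=
  agree L (uz W) (uenv W e) (uz W') (uenv W' e').

(** Whether an operation passes [0] depends on the environment, so both outcomes are kept at each
    opposite and each sum. *)
Lemma term_forms n (t : term n) : exists Ls : seq (linform n),
  forall (G : cogType) (W : unwinding G) (e : n.-tuple G),
  (exists2 l, l \in Ls & fval (uz W) (uenv W e) l = urep W (eval e t)) /\
  (forall l, l \in Ls ->
     exists k : int, fval (uz W) (uenv W e) l = urep W (eval e t) + uz W *~ k).
Proof.
elim: t => [i||t [Ls H]|t [Ls H] u [Ls' H']].
- exists [:: lvar i] => G W e; rewrite /= -[urep W _]/(uenv W e i).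
  split; first by exists (lvar i); rewrite ?mem_head// fval_var.
  by move=> l; rewrite inE => /eqP ->; exists 0; rewrite fval_var mulr0z addr0.
- exists [:: 0] => G W e; rewrite /= urep0.
  have e0 : fval (uz W) (uenv W e) 0 = 0 by rewrite raddf0.
  split; first by exists 0; rewrite ?mem_head.
  by move=> l; rewrite inE => /eqP ->; exists 0; rewrite e0 mulr0z addr0.
- exists ([seq - l | l <- Ls] ++ [seq luz n - l | l <- Ls]) => G W e /=.
  have [[l lL el] H2] := H G W e; have N := urepN W (eval e t).
  split.
    case: N => ->; [exists (- l)|exists (luz n - l)];
      rewrite ?mem_cat ?map_f ?orbT ?fvalD ?fvalN ?fval_uz ?el//.
    by apply/orP; right; apply/mapP; exists l.
  have [k ek] : exists k : int, urep W (- eval e t) = - urep W (eval e t) + uz W *~ k.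
    by case: N => ->; [exists 0; rewrite mulr0z addr0|exists 1; rewrite addrC].
  move=> m; rewrite mem_cat => /orP[]/mapP[l' /H2[j ej] ->].
    exists (- j - k); rewrite fvalN ej ek mulrzBr mulrNz opprD -addrA; congr (_ + _).
    by rewrite [RHS]addrC subrK.
  exists (1 - j - k); rewrite fvalD fvalN fval_uz ej ek !mulrzBr opprD addrCA -addrA.
  by congr (_ + _); rewrite mulr1z [RHS]addrC subrK.
- exists ([seq l + l' | l <- Ls, l' <- Ls'] ++ [seq l + l' - luz n | l <- Ls, l' <- Ls']).
  move=> G W e /=.
  have [[l lL el] H2] := H G W e; have [[l' lL' el'] H2'] := H' G W e.
  have N := urepD W (eval e t) (eval e u).
  split.
    case: N => ->; [exists (l + l')|exists (l + l' - luz n)];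
      rewrite ?mem_cat ?fvalD ?fvalN ?fval_uz ?fvalD ?el ?el'//; apply/orP; [left|right];
      by apply/allpairsP; exists (l, l').
  have [k ek] : exists k : int, urep W (eval e t + eval e u) =
      urep W (eval e t) + urep W (eval e u) + uz W *~ k.
    by case: N => ->; [exists 0; rewrite mulr0z addr0|exists (-1); rewrite mulrNz].
  move=> m; rewrite mem_cat => /orP[]/allpairsP[[a b] /= [/H2[i ei] /H2'[j ej] ->]].
    exists (i + j - k); rewrite fvalD ei ej ek mulrzBr mulrzDr addrACA -[RHS]addrA.
    by congr (_ + _); rewrite [RHS]addrC subrK.
  exists (i + j - 1 - k); rewrite !fvalD fvalN fval_uz ei ej ek !mulrzBr mulrzDr.
  rewrite [X in X - _]addrACA -[LHS]addrA -[RHS]addrA mulr1z; congr (_ + _).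
  by rewrite [RHS]addrC subrK.
Qed.

(** The form lifting a term in [W] is singled out by [0 <= l < z], a condition expressed by atoms;
    so the same form lifts the term in [W'], by [urep_uniq]. *)
Lemma terms_lt n (t u : term n) : exists L : seq (atom n),
  forall G (W : unwinding G) e G' (W' : unwinding G') e', uagree L W e W' e' ->
  urep W (eval e t) < urep W (eval e u) -> urep W' (eval e' t) < urep W' (eval e' u).
Proof.
have [L1 H1] := term_forms t; have [L2 H2] := term_forms u.
exists ([seq (None, l + lconst n 1) | l <- L1 ++ L2] ++
        [seq (None, luz n - l) | l <- L1 ++ L2] ++
        [seq (None, l' - l) | l <- L1, l' <- L2]).
move=> G W e G' W' e' ag.
have [[l lL el] _] := H1 G W e; have [[m mL em] _] := H2 G W e.
have [_ kl] := H1 G' W' e'; have [_ km] := H2 G' W' e'.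
have A (v : term n) f : f \in L1 ++ L2 -> fval (uz W) (uenv W e) f = urep W (eval e v) ->
   (exists k : int, fval (uz W') (uenv W' e') f = urep W' (eval e' v) + uz W' *~ k) ->
   fval (uz W') (uenv W' e') f = urep W' (eval e' v).
  move=> fL ef [k]; apply: urep_uniq; rewrite ?urep_ge0 ?urep_lt//.
    have [|+ _] := ag (None, f + lconst n 1); first by rewrite mem_cat map_f.
    rewrite /holds /= !fvalD !fval_const !mulr1z !dlt_addone; apply.
    by rewrite ef urep_ge0.
  have [|+ _] := ag (None, luz n - f); first by rewrite !mem_cat (map_f _ fL) orbT.
  rewrite /holds /= !fvalD !fvalN !fval_uz !dsubr_gt0; apply.
  by rewrite ef urep_lt.
have lL' : l \in L1 ++ L2 by rewrite mem_cat lL.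
have mL' : m \in L1 ++ L2 by rewrite mem_cat mL orbT.
rewrite -(A t l lL' el (kl l lL)) -(A u m mL' em (km m mL)) -el -em.
have [|+ _] := ag (None, m - l).
  by rewrite !mem_cat; do 2! (apply/orP; right); apply/allpairsP; exists (l, m).
by rewrite /holds /= !fvalD !fvalN !dsubr_gt0.
Qed.

Lemma uenv_cons (G : cogType) (W : unwinding G) n (e : n.-tuple G) (x : G) :
  uenv W [tuple of x :: e] = econs (urep W x) (uenv W e).
Proof.
apply/funext => i; rewrite /uenv /econs; case: unliftP => [j|] ->; first by rewrite tnthS.
by rewrite tnth0.
Qed.

(** One implication is enough since agreement is symmetric: negation uses the hypothesis backwards,
    and an equality is transferred by refuting both strict inequalities. *)
Lemma uagree_sat n (f : formula n) : exists L : seq (atom n),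
  forall G (W : unwinding G) e G' (W' : unwinding G') e', z_group W -> z_group W' ->
  uagree L W e W' e' -> sat f e -> sat f e'.
Proof.
elim: f => {n} n.
- move=> t u; have [L1 H1] := terms_lt t u; have [L2 H2] := terms_lt u t.
  exists (L1 ++ L2) => G W e G' W' e' _ _ ag /= tu; apply: (@urep_inj _ W').
  have ag1 : uagree L1 W' e' W e by apply/agree_sym/agreeW/ag => a; rewrite mem_cat => ->.
  have ag2 : uagree L2 W' e' W e.
    by apply/agree_sym/agreeW/ag => a; rewrite mem_cat orbC => ->.
  case: (ltgtP (urep W' (eval e' t)) (urep W' (eval e' u))) => //.
    by move=> /(H1 _ _ _ _ _ _ ag1); rewrite tu ltxx.
  by move=> /(H2 _ _ _ _ _ _ ag2); rewrite tu ltxx.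
- move=> t u v; have [L1 H1] := terms_lt t u; have [L2 H2] := terms_lt u v.
  have [L3 H3] := terms_lt v t.
  exists (L1 ++ L2 ++ L3) => G W e G' W' e' _ _ ag /= /(urep_cyc W) h.
  have ag1 : uagree L1 W e W' e' by apply/agreeW/ag => a; rewrite mem_cat => ->.
  have ag2 : uagree L2 W e W' e' by apply/agreeW/ag => a; rewrite !mem_cat => ->; rewrite orbT.
  have ag3 : uagree L3 W e W' e' by apply/agreeW/ag => a; rewrite !mem_cat => ->; rewrite !orbT.
  apply/(urep_cyc W'); case/or3P: h => /andP[].
  + by move=> /(H1 _ _ _ _ _ _ ag1) -> /(H2 _ _ _ _ _ _ ag2) ->.
  + by move=> /(H2 _ _ _ _ _ _ ag2) -> /(H3 _ _ _ _ _ _ ag3) ->; rewrite orbT.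
  + by move=> /(H3 _ _ _ _ _ _ ag3) -> /(H1 _ _ _ _ _ _ ag1) ->; rewrite !orbT.
- move=> f [L H]; exists L => G W e G' W' e' zW zW' /agree_sym ag /= nf.
  by apply: contra_not nf; exact: H ag.
- move=> f [L H] g [L' H']; exists (L ++ L') => G W e G' W' e' zW zW' ag /= [hf hg].
  split; [apply: H hf|apply: H' hg] => //; apply/agreeW/ag => a; rewrite mem_cat => -> //.
  by rewrite orbT.
- move=> f [L H].
  (* The two extra atoms force the witness into [[0, z'[], hence to represent an element of [G']. *)
  have [L' H'] := back_forth (L ++ [:: (None, lvar ord0 + lconst n.+1 1); (None, luz n.+1 - lvar ord0)]).
  exists L' => G W e G' W' e' zW zW' ag /= [x hx].
  have [x' ag'] := H' _ _ _ _ _ _ zW ag _ (urep_ge0 W x).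
  have [y ey] : exists y, urep W' y = x'.
    apply: urep_surj.
      have [|+ _] := ag' (None, lvar ord0 + lconst n.+1 1); first by rewrite mem_cat !inE eqxx orbT.
      rewrite /holds /= !fvalD !fval_const !fval_var /econs !unlift_none /= !mulr1z !dlt_addone.
      by apply; exact: urep_ge0.
    have [|+ _] := ag' (None, luz n.+1 - lvar ord0); first by rewrite mem_cat !inE eqxx !orbT.
    rewrite /holds /= !fvalD !fvalN !fval_uz !fval_var /econs !unlift_none /= !dsubr_gt0.
    by apply; exact: urep_lt.
  exists y; apply: (H _ W _ _ W') hx => //.
  by rewrite /uagree !uenv_cons ey; apply/agreeW/ag' => a; rewrite mem_cat => ->.
Qed.

(** * Sentences and the residues of the cofinal element *)

Lemma fval0E (V : dogType) (z : V) (e : 'I_0 -> V) f :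
  fval z e f = dog1 *~ f.1.1 + z *~ f.1.2.
Proof. by rewrite /fval -lock big_ord0 addr0. Qed.

(** With [z] standard, a closed form has the value [dog1 *~ k] for the same [k] in both covers, and
    its sign and divisibility are those of [k]. *)
Lemma equiv_std (G G' : cogType) (W : unwinding G) (W' : unwinding G') (N : nat) :
  z_group W -> z_group W' -> uz W = dog1 *+ N -> uz W' = dog1 *+ N ->
  elementarily_equivalent G G'.
Proof.
move=> zW zW' e e' f; have [L H] := uagree_sat f.
have ag : uagree L W [tuple] W' [tuple].
  move=> a _; rewrite /holds !fval0E e e' !pmulrn -!mulrzA -!mulrzDr.
  have E (V : dogType) (k : int) : (0 < dog1 *~ k :> V) = (0 < k).
    by rewrite -{1}(mulr0z dog1) dltMz// dog1_gt0.
  case: a.1 => [m|]; last by rewrite !E.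
  exact: iff_trans (ddvd_dog1 _ _ _) (iff_sym (ddvd_dog1 _ _ _)).
by split; apply: H => //; exact: agree_sym.
Qed.

Lemma fval0_large (V : dogType) (z : V) (B : nat) (c d : int) :
  dog1 *+ B < z -> (`|c| <= B)%N ->
  (0 < dog1 *~ c + z *~ d) = (0 < d) || (d == 0) && (0 < c).
Proof.
move=> Bz cB; have o0 : 0 < dog1 :> V by exact: dog1_gt0.
have z0 : 0 < z by apply: le_lt_trans Bz; rewrite -(mulr0z dog1) pmulrn dleMz.
have cz (k : int) : (`|k| <= B)%N -> dog1 *~ k < z.
  by move=> kB; apply: le_lt_trans Bz; rewrite pmulrn dleMz//; lia.
have ez : z = z *~ 1 by [].
case: (ltgtP d 0) => [d0|d0|->] /=; last by rewrite mulr0z addr0 -{1}(mulr0z dog1) dltMz.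
  apply/negbTE; rewrite -leNgt ltW// -[d]opprK mulrNz dltBl add0r.
  by apply: lt_le_trans (cz _ cB) _; rewrite {1}ez dleMz//; lia.
rewrite addrC -[c]opprK mulrNz dsubr_gt0.
apply: (@lt_le_trans _ _ z); first by apply: cz; rewrite abszN.
by rewrite {1}ez dleMz//; lia.
Qed.

(** For a sentence the remaining atoms concern [c + d z]. Once [z] exceeds the bound [B] on the
    constants, the sign is read off [d], then [c]; divisibility depends on [z] modulo the product
    [M] of the moduli. *)
Lemma sat_residue (f : sentence) : exists M B : nat, (0 < M)%N /\
  forall (G G' : cogType) (W : unwinding G) (W' : unwinding G') w w' (r : nat),
  z_group W -> z_group W' -> dog1 *+ B < uz W -> dog1 *+ B < uz W' ->
  uz W = w *+ M + dog1 *+ r -> uz W' = w' *+ M + dog1 *+ r ->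
  sat f [tuple of [::] : seq G] <-> sat f [tuple of [::] : seq G'].
Proof.
have [L H] := uagree_sat f.
pose M := (\prod_(a <- L) amod a)%N; pose B := (\sum_(a <- L) `|a.2.1.1|)%N.
exists M, B; split; first by apply: prodn_gt0 => -[[]].
move=> G G' W W' w w' r zW zW' Bz Bz' e e'.
have ag : uagree L W [tuple] W' [tuple].
  move=> a aL; have dM : (amod a %| M)%N := dvdn_prod_seq (@amod 0) aL.
  have cB : (`|a.2.1.1| <= B)%N by rewrite /B (big_rem a)//= leq_addr.
  case: a aL dM cB => [[m|] l] aL /= dM cB; rewrite /holds /= !fval0E; last first.
    by rewrite !(fval0_large _ _ cB).
  have E (V : dogType) (z v : V) : z = v *+ M + dog1 *+ r ->
      ddvd m.+1 (dog1 *~ l.1.1 + z *~ l.1.2) <-> (m.+1%:Z %| l.1.1 + Posz r * l.1.2)%Z.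
    move=> ->; rewrite mulrzDl addrCA; apply: iff_trans.
      apply: ddvdD; exists (v *~ l.1.2 *+ (M %/ m.+1)%N).
      by rewrite -mulrnA divnK// !pmulrn mulrzAC.
    rewrite pmulrn -mulrzA -mulrzDr; exact: ddvd_dog1.
  exact: iff_trans (E _ _ _ e) (iff_sym (E _ _ _ e')).
by split; apply: H => //; exact: agree_sym.
Qed.

Lemma uz_int n : uz (int_unwinding n) = dog1 *+ n.+1.
Proof. exact: (esym (natz n.+1)). Qed.

(** * c-regular discrete groups *)

Lemma cycsE (G : cogType) (s : seq G) : size s != 2%N ->
  cycs s <-> (forall i j k : nat, (i < j < k)%N -> (k < size s)%N ->
           cyc (nth 0 s i) (nth 0 s j) (nth 0 s k)).
Proof. by case: s => [|x [|y []]]. Qed.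

Definition ularge (G : cogType) (W : unwinding G) := forall B, dog1 *+ B < uz W.

(** This separates the finite groups from the infinite ones. *)
Lemma uz_dichotomy (G : cogType) (W : unwinding G) :
  (exists N, uz W = dog1 *+ N) \/ ularge W.
Proof.
have [|/existsNP[B /negP]] := pselect (ularge W); [by right|rewrite -leNgt => h; left].
by have [N _ ->] := le_dog1_muln (ltW (uz_gt0 W)) h; exists N.
Qed.

Section RegularUnwinding.
Variables (G : cogType) (W : unwinding G).
Implicit Types (a b x : G).
Local Notation z := (uz W).
Local Notation rep := (@urep G W).

(** Every element of the cover is then a multiple of [dog1], so the quotient [0] will do. *)
Lemma z_group_std (N : nat) : z = dog1 *+ N -> z_group W.
Proof.
move=> ez n x; have [a [k ->]] := urep_dec x.
have [|j _ ->] := @le_dog1_muln _ (rep a) N (urep_ge0 W a).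
  by rewrite -ez ltW// urep_lt.
exists 0, (Posz j + Posz N * k).
by rewrite mul0rn add0r ez !pmulrn mulrzDr mulrzA.
Qed.

Lemma urepD_small a b : rep a + rep b < z -> rep (a + b) = rep a + rep b.
Proof.
move=> h; case: (urepD W a b) => // e.
by have := urep_ge0 W (a + b); rewrite e leNgt dltBl add0r h.
Qed.

Lemma urepM_small a x n : rep x *+ n + rep a < z -> rep (a + x *+ n) = rep a + rep x *+ n.
Proof.
elim: n => [|n IH] h; first by rewrite !mulr0n !addr0.
have h' : rep x *+ n + rep a < z.
  apply: le_lt_trans h; rewrite dleD2r mulrSr -{1}[rep x *+ n]addr0 dleD2l.
  exact: urep_ge0.
by rewrite !mulrSr !addrA urepD_small IH// -addrA -mulrSr addrC.
Qed.

(** A turn at some step would bring the representative below the preceding one. *)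
Lemma urepM_incr x q : (forall i : nat, (0 < i)%N -> (i.+1 < q)%N ->
  cyc 0 (x *+ i) (x *+ i.+1)) -> forall i, (i < q)%N -> rep (x *+ i) = rep x *+ i.
Proof.
move=> H; elim=> [|i IH] iq; first by rewrite urep0.
case: (posnP i) => [->//|i0].
have := H _ i0 iq; rewrite (cyc0_urep W) => /andP[_].
rewrite !mulrSr; case: (urepD W (x *+ i) x) => -> .
  by rewrite IH// ltnW.
rewrite -addrA -[X in X < _]addr0 dltD2l dltBr add0r => /lt_le_trans/(_ (ltW (urep_lt W x))).
by rewrite ltxx.
Qed.

Lemma urep_mulrn_le x i j : (i <= j)%N -> rep x *+ i <= rep x *+ j.
Proof.
move=> /subnK <-; rewrite mulrnDr -{1}[rep x *+ i]add0r dleD2r.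
by elim: (j - i)%N => // n IH; rewrite mulrSr -[0]addr0 dleD// urep_ge0.
Qed.

Lemma cycs_mkseq x q : (1 < q)%N ->
  cycs (mkseq (fun i => x *+ i) q) <->
  x <> 0 /\ forall i, (i < q)%N -> rep (x *+ i) = rep x *+ i.
Proof.
(* For [q = 2] the convention on [cycs] leaves only [0 <> x]. *)
move=> q1; have [->|/eqP q2] := eqVneq q 2%N.
  split=> [|[x0 _]]; last by rewrite /= => /esym.
  rewrite /= => x0; split; first by move=> e; apply: x0; rewrite e.
  by case=> [|[|]]//; rewrite urep0.
rewrite cycsE ?size_mkseq; last exact/eqP.
split=> [H|[/eqP x0 H] i j k /andP[ij jk] kq]; last first.
  have jq := ltn_trans jk kq; have iq := ltn_trans ij jq.
  rewrite !nth_mkseq//; apply/(urep_cyc W); rewrite !H//.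
  have L m p : (m < p)%N -> rep x *+ m < rep x *+ p.
    move=> mp; rewrite -(subnK mp) addnS mulrS mulrnDr addrA -{1}[rep x *+ m]add0r.
    rewrite dltD2r -[X in X < _]addr0; apply: dlt_leD; first by rewrite urep_gt0.
    by rewrite -(mulr0n (rep x)) urep_mulrn_le.
  by rewrite (L _ _ ij) (L _ _ jk).
have H' i j : (0 < i)%N -> (i < j)%N -> (j < q)%N -> cyc 0 (x *+ i) (x *+ j).
  move=> i0 ij jq; have := H 0%N i j; rewrite i0 ij !nth_mkseq//.
    by apply.
  - exact: ltn_trans jq.
  - exact: ltn_trans q1.
split; last by apply: urepM_incr => i i0 iq; exact: H'.
have [] // := cyc_neq (H' 1%N 2%N _ _ _); first by move: q1 q2; lia.
by move=> + _ _ e; apply; rewrite e.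
Qed.

Lemma ex_is_one : dog1 < z -> exists2 e, is_one e & rep e = dog1.
Proof.
move=> z1; have [e er] := urep_surj (ltW (dog1_gt0 W)) z1; exists e => //.
have e0 : 0 < rep e by rewrite er dog1_gt0.
split=> [e00|x /eqP x0 xe]; first by move: e0; rewrite e00 urep0 ltxx.
apply/(cyc0_urep W); rewrite e0 /= er lt_neqAle.
rewrite -(urep_gt0 W) in x0; rewrite dog1_min// andbT -er.
by apply/eqP => /urep_inj/esym.
Qed.

Lemma is_one_uniq (e e' : G) : is_one e -> is_one e' -> e = e'.
Proof.
move=> [e0 h] [e'0 h']; apply: contrapT => ee'.
have ee'' : e' <> e by move=> e1; apply: ee'.
exact: cyc_asym (h _ e'0 ee'') (h' _ e0 ee').
Qed.

Lemma urep_oneG : dog1 < z -> rep (oneG G) = dog1.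
Proof.
move=> /ex_is_one[e he <-]; congr rep; apply: is_one_uniq (he).
exact: (xgetPex 0 (ex_intro _ e he)).
Qed.

Lemma large_lt (i j : nat) : (i <= j)%N -> dog1 *+ j < z -> dog1 *+ i < z.
Proof. by move=> ij; apply: le_lt_trans; rewrite !pmulrn dleMz// dog1_gt0. Qed.

(* The multiples of [x] turn exactly once around the circle, at the last step,
   so [x *+ q = k] in [G] lifts to [x *+ q = z + k]. *)
Lemma D_ddvd (q k : nat) : (1 < q)%N -> (k < q)%N -> dog1 *+ (q * q) < z ->
  D G q k <-> ddvd q (z + dog1 *+ k).
Proof.
move=> q1 kq qz; have q0 := ltnW q1.
have z1 : dog1 < z by rewrite -[dog1]mulr1n; apply: large_lt qz; rewrite muln_gt0 q0.
have rone : rep (oneG G *+ k) = dog1 *+ k.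
  have := urepM_small (a := 0) (x := oneG G) (n := k).
  rewrite urep0 !add0r urep_oneG// addr0; apply.
  by apply: large_lt qz; apply: leq_trans (ltnW kq) (leq_pmulr _ q0).
have eq1 (V : nmodType) (v : V) : v *+ q = v *+ q.-1 + v by rewrite -mulrSr prednK.
split=> [[x [/(cycs_mkseq x q1)[x0 H] e]]|[y ey]].
  have : rep (x *+ q) = dog1 *+ k by rewrite e rone.
  (* Without a turn at the last step, [rep x *+ q] would be [k < q] although [rep x >= 1]. *)
  rewrite eq1; case: (urepD W (x *+ q.-1) x) => ->; rewrite H ?prednK// -eq1 => e'.
    have : dog1 *+ q <= rep x *+ q.
      by rewrite leNgt dltMn2// -leNgt dog1_min// urep_gt0; apply/eqP.
    by rewrite e' !pmulrn dleMz ?dog1_gt0//; lia.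
  by exists (rep x); rewrite -e' addrC subrK.
have y0 : 0 < y.
  rewrite -(dpmuln_gt0 _ q0) -ey -[0]addr0; apply: dlt_leD (uz_gt0 W) _.
  by rewrite pmulrn -(mulr0z dog1) dleMz// dog1_gt0.
have yz : y *+ q.-1 < z.
  (* After multiplication by [q] the claim is [(q - 1)(z + k) < q z], that is [k (q - 1) < z]: hence
     the bound [q * q]. *)
  rewrite -(dltMn2 _ _ q0) -mulrnA mulnC mulrnA -ey mulrnDl.
  rewrite [X in _ < X]eq1 dltD2l -mulrnA; apply: large_lt qz.
  by apply: leq_mul; [exact: ltnW|exact: leq_pred].
have yM i : (i < q)%N -> y *+ i <= y *+ q.-1.
  by move=> iq; rewrite !pmulrn dleMz//; lia.
have [x ex] : exists x, rep x = y.
  apply: urep_surj; first exact: ltW.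
  by apply: le_lt_trans yz; rewrite -{1}[y]mulr1n; apply: yM.
have H i : (i < q)%N -> rep (x *+ i) = rep x *+ i.
  move=> iq; have := urepM_small (a := 0) (x := x) (n := i).
  by rewrite urep0 !add0r addr0; apply; rewrite ex; apply: le_lt_trans yz; exact: yM.
exists x; split; first apply/(cycs_mkseq x q1); first split => //.
  by move=> x0; move: y0; rewrite -ex x0 urep0 ltxx.
apply: (@urep_inj _ W); rewrite rone eq1.
case: (urepD W (x *+ q.-1) x) (urep_lt W (x *+ q.-1 + x)) => ->;
  rewrite H ?prednK// -eq1 ex -ey.
  by rewrite -{2}[z]addr0 dltD2l pmulrn -(mulr0z dog1) dltMz ?dog1_gt0.
by rewrite addrC addKr.
Qed.

(* c-[q]-regularity applied to [q] consecutive elements [a, a + 1, ...] yields a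
   multiple of [q] among them, reached without going around the circle when [a]
   is not too close to [z]. *)
Lemma c_regular_z_group : c_regular G -> ularge W -> z_group W.
Proof.
move=> rG zl n; case: n => [|n].
  by move=> x; exists x, 0; rewrite mulr0z addr0.
set q := n.+2.
pose P (x : W) := exists (y : W) (r : int), x = y *+ q + dog1 *~ r.
have PD (x y : W) : P x -> P y -> P (x + y).
  move=> [u [r ->]] [v [s ->]]; exists (u + v), (r + s).
  by rewrite mulrzDr mulrnDl addrACA.
have PM (x : W) (k : int) : P x -> P (x *~ k).
  move=> [u [r ->]]; exists (u *~ k), (r * k).
  by rewrite mulrzDl -mulrzA !pmulrn mulrzAC.
have P1 (r : int) : P (dog1 *~ r) by exists 0, r; rewrite mul0rn add0r.
have P1n (m : nat) : P (dog1 *+ m) by rewrite pmulrn.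
have z1 : dog1 < z by exact: (zl 1%N).
have [e _ er] := ex_is_one z1.
have key a : 0 < rep a -> rep a + dog1 *+ (q + q) <= z -> P (rep a).
  move=> a0 az.
  have rS i : (i < q + q)%N -> rep (a + e *+ i) = rep a + dog1 *+ i.
    move=> iq; rewrite urepM_small er//; apply: lt_le_trans az.
    by rewrite addrC dltD2l !pmulrn dltMz// dog1_gt0.
  have [s sn] : exists s : q.-tuple G, forall i, (i < q)%N -> nth 0 s i = a + e *+ i.
    exists [tuple a + e *+ i | i < q] => i iq.
    by rewrite -(tnth_nth 0 _ (Ordinal iq)) tnth_mktuple.
  have s0 : head 0 s = a by rewrite -nth0 sn// addr0.
  have sl : last 0 s = a + e *+ n.+1 by rewrite (last_nth 0) size_tuple /= -[RHS]sn.
  have L i j : (i < j)%N -> (j < q)%N -> rep (nth 0 s i) < rep (nth 0 s j).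
    move=> ij jq; have iq := ltn_trans ij jq; rewrite !sn// !rS ?ltn_addr//.
    by rewrite dltD2l !pmulrn dltMz// dog1_gt0.
  have L0 j : (j < q)%N -> 0 < rep (nth 0 s j).
    case: j => [|j] jq; first by rewrite sn// addr0.
    by apply: lt_trans (L 0%N j.+1 _ jq) => //; rewrite sn// addr0.
  have [|x [xq]] := rG q isT s.
    apply/cycsE; rewrite /= size_tuple// => i j k /andP[ij jk] kq.
    have M m p : (m < p)%N -> (p < q.+1)%N -> rep (nth 0 (0 :: s) m) < rep (nth 0 (0 :: s) p).
      by case: m => [|m]; case: p => [|p]//= mp pq; [rewrite urep0; exact: L0|exact: L].
    apply/(urep_cyc W); rewrite (M _ _ ij) ?(M _ _ jk)//; exact: ltn_trans kq.
  rewrite s0 sl in xq * => Hx.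
  have {}Hx : forall i j k : nat, (i < j < k)%N -> (k < q.+1)%N ->
      cyc (nth 0 (rcons (mkseq (fun i => x *+ i) q) (a + e *+ n.+1)) i)
          (nth 0 (rcons (mkseq (fun i => x *+ i) q) (a + e *+ n.+1)) j)
          (nth 0 (rcons (mkseq (fun i => x *+ i) q) (a + e *+ n.+1)) k).
    move/cycsE: Hx; rewrite size_rcons size_mkseq => H i j k ijk kq; exact: H.
  have nx i : (i < q)%N -> nth 0 (rcons (mkseq (fun i => x *+ i) q) (a + e *+ n.+1)) i = x *+ i.
    by move=> iq; rewrite nth_rcons size_mkseq iq nth_mkseq.
  have nl : nth 0 (rcons (mkseq (fun i => x *+ i) q) (a + e *+ n.+1)) q = a + e *+ n.+1.
    by rewrite nth_rcons size_mkseq ltnn eqxx.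
  have xM : forall i, (i < q)%N -> rep (x *+ i) = rep x *+ i.
    apply: urepM_incr => i i0 iq; have := Hx 0%N i i.+1.
    by rewrite !nx ?mulr0n//; [apply; rewrite ?i0/=|exact: ltnW]; rewrite ?ltnS// ltnW.
  have := Hx 0%N n.+1 q; rewrite nl !nx// => /(_ (ltnSn _) (ltnSn _)).
  rewrite mulr0n (cyc0_urep W) xM// => /andP[_ xl].
  have rl : rep (a + e *+ n.+1) = rep a + dog1 *+ n.+1 by rewrite rS// /q; lia.
  have [x1 x2] : rep a <= rep (x *+ q) /\ rep (x *+ q) <= rep a + dog1 *+ n.+1.
    have al : rep a < rep a + dog1 *+ n.+1.
      by rewrite -{1}[rep a]addr0 dltD2l dpmuln_gt0// dog1_gt0.
    case: xq => [->|->|]; [by rewrite lexx ltW|by rewrite rl lexx ltW|].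
    move/(urep_cyc W); rewrite rl; case/or3P => /andP[h h']; first by rewrite !ltW.
      by have := lt_trans h' al; rewrite ltxx.
    by have := lt_trans h al; rewrite ltxx.
  (* A turn at the last step would give [rep (x *+ q) < 2 (a + q - 1) - z <= a], against [x1]; the
     margin [q + q] is there for this. *)
  have ex : rep (x *+ q) = rep x *+ q.
    rewrite /q !(mulrSr _ n.+1); case: (urepD W (x *+ n.+1) x) => ex; rewrite ex xM//.
    move: x1; rewrite /q (mulrSr x) ex xM// leNgt => /negP[].
    rewrite dltBl.
    have xx : rep x <= rep x *+ n.+1 by rewrite -{1}[rep x]mulr1n urep_mulrn_le.
    rewrite rl in xl.
    apply: lt_le_trans (dlt_leD xl (le_trans xx (ltW xl))) _.
    rewrite -addrA dleD2l addrCA -mulrnDr; apply: le_trans az.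
    rewrite dleD2l !pmulrn dleMz ?dog1_gt0// /q; lia.
  have [||j _ ej] := @le_dog1_muln _ (rep (x *+ q) - rep a) n.+1.
  - by rewrite -(dleD2r (rep a)) add0r subrK.
  - by rewrite -(dleD2r (rep a)) subrK addrC.
  exists (rep x), (- Posz j); rewrite -ex mulrNz -pmulrn -ej opprB addrC subrK//.
(* [z] is reached from the representative [z - (q + q)], to which [key] applies. *)
have Pz : P z.
  have zq : 0 < z - dog1 *+ (q + q) by rewrite dsubr_gt0.
  have [|a ea] := urep_surj (W := W) (ltW zq).
    by rewrite dltBl -{1}[z]addr0 dltD2l dpmuln_gt0// dog1_gt0.
  rewrite -[z](subrK (dog1 *+ (q + q))); apply: (PD); last exact: P1n.
  by rewrite -ea; apply: (key); rewrite ea// subrK.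
move=> x; have [a [k ->]] := urep_dec x; apply: (PD); last exact: PM.
case: (eqVneq a 0) => [->|a0]; first by rewrite urep0; exact: (P1n 0%N).
rewrite -(urep_gt0 W) in a0.
(* An element too close to [z] is first moved back by [q + q]. *)
have [h|h] := leP (rep a + dog1 *+ (q + q)) z; first exact: key.
have h0 : 0 < rep a - dog1 *+ (q + q).
  rewrite dsubr_gt0 -(dltD2r (dog1 *+ (q + q))); apply: lt_trans h.
  by rewrite -mulrnDr.
have [|b eb] := urep_surj (W := W) (ltW h0).
  rewrite dltBl; apply: lt_le_trans (urep_lt W a) _.
  by rewrite -{1}[z]addr0 dleD2l ltW// dpmuln_gt0// dog1_gt0.
rewrite -[rep a](subrK (dog1 *+ (q + q))); apply: (PD); last exact: P1n.
by rewrite -eb; apply: (key); rewrite eb// subrK ltW// urep_lt.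
Qed.

End RegularUnwinding.

Lemma exists_unwinding (G : cogType) : c_regular G -> discrete G ->
  exists W : unwinding G, z_group W.
Proof.
move=> rG [G0|[e he]].
  exists (trivial_unwinding G0); apply: int_dog_zgroup.
exists (unwound_unwinding he); case: (uz_dichotomy (unwound_unwinding he)) => [[N]|].
  exact: z_group_std.
exact: c_regular_z_group.
Qed.

(** * Los's theorem *)

Section Los.
Variables (I : Type) (U : set_system I) (UF : UltraFilter U) (G : I -> cogType).

Definition tpi n (e : n.-tuple (dep_prod G)) : n.-tuple (ultraproduct UF G) :=
  [tuple of map (ultra_pi UF (G := G)) e].

Definition tat n (i : I) (e : n.-tuple (dep_prod G)) : n.-tuple (G i) :=
  [tuple of map (fun x : dep_prod G => x i) e].

Lemma ultra_pi0 : ultra_pi UF (0 : dep_prod G) = 0.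
Proof. by apply: (addrI (ultra_pi UF (0 : dep_prod G))); rewrite -ultra_pi_add !addr0. Qed.

Lemma ultra_pi_opp (x : dep_prod G) : ultra_pi UF (- x) = - ultra_pi UF x.
Proof.
apply/eqP; rewrite -addr_eq0 -ultra_pi_add addNr; apply/eqP.
exact: ultra_pi0.
Qed.

Lemma eval_ultra n (e : n.-tuple (dep_prod G)) (t : term n) :
  eval (tpi e) t = ultra_pi UF ((fun i => eval (tat i e) t) : dep_prod G).
Proof.
elim: t => [i||t IH|t IH u IH'] /=.
- rewrite tnth_map; congr ultra_pi.
  by apply: functional_extensionality_dep => j; rewrite tnth_map.
- by rewrite -ultra_pi0.
- by rewrite IH -ultra_pi_opp.
- by rewrite IH IH' -ultra_pi_add.
Qed.

Lemma sat_ultra n (f : formula n) (e : n.-tuple (dep_prod G)) :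
  sat f (tpi e) <-> U [set i | sat f (tat i e)].
Proof.
elim: f e => {n} n.
- by move=> t u e /=; rewrite !eval_ultra; exact: ultra_piE.
- by move=> t u v e /=; rewrite !eval_ultra; exact: ultra_cycE.
- move=> f IH e /=; split=> [nf|Unf /IH Uf]; last first.
    by have [i [/=]] := filter_ex (filterI Unf Uf).
  by case: (in_ultra_setVsetC [set i | sat f (tat i e)] UF) => // /IH.
- move=> f IHf g IHg e /=; split=> [[/IHf Uf /IHg Ug]|Ufg].
    exact: filterI.
  by split; [apply/IHf|apply/IHg]; apply: filterS Ufg => i [].
- move=> f IH e /=.
  have C (x : dep_prod G) : sat f [tuple of ultra_pi UF x :: tpi e] <->
      U [set i | sat f [tuple of x i :: tat i e]].
    have -> : [tuple of ultra_pi UF x :: tpi e] = tpi [tuple of x :: e] by exact: val_inj.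
    apply: iff_trans (IH _) _; rewrite (_ : [set i | _] = [set i | sat f [tuple of x i :: tat i e]])//.
    by apply/seteqP; split=> i /=; congr sat; exact: val_inj.
  split=> [[x]|Uex].
    by rewrite -(ultra_repr x) => /C; apply: filterS => i /= h; exists ((repr x : dep_prod G) i).
  (* A witness at each index, and [0] at the indices without one, which lie outside a set of [U]. *)
  pose x : dep_prod G := fun i => xget 0 [set y | sat f [tuple of y :: tat i e]].
  exists (ultra_pi UF x); apply/C; apply: filterS Uex => i /= h.
  exact: (xgetPex 0 h).
Qed.

Lemma sat_ultra0 (f : sentence) :
  sat f [tuple of [::] : seq (ultraproduct UF G)] <->
  U [set i | sat f [tuple of [::] : seq (G i)]].
Proof.
have := sat_ultra f [tuple]; rewrite (_ : tpi _ = [tuple of [::]]); last exact: val_inj.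
move=> h; apply: iff_trans h _; rewrite (_ : [set i | _] = [set i | sat f [tuple of [::] : seq (G i)]])//.
by apply/seteqP; split=> i /=; congr sat; exact: val_inj.
Qed.

End Los.

(** * First-order axiomatisation *)

Definition ftrue n : formula n := FEq TZero TZero.
Definition fforall n (f : formula n.+1) : formula n := FNot (FEx (FNot f)).
Definition fdisj n (f g : formula n) : formula n := FNot (FAnd (FNot f) (FNot g)).
Definition fimp n (f g : formula n) : formula n := FNot (FAnd f (FNot g)).

Fixpoint fconjs n (m : nat) (F : nat -> formula n) : formula n :=
  if m is k.+1 then FAnd (F k) (fconjs k F) else ftrue n.

Definition fcycs n (ts : seq (term n)) : formula n :=
  match ts with
  | [:: t; u] => FNot (FEq t u)
  | _ => fconjs (size ts) (fun k => fconjs k (fun j => fconjs j (fun i =>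
           FCyc (nth TZero ts i) (nth TZero ts j) (nth TZero ts k))))
  end.

Fixpoint tmuln n (t : term n) (k : nat) : term n :=
  if k is j.+1 then TAdd t (tmuln t j) else TZero.

Fixpoint fclose n : formula n -> sentence :=
  if n is k.+1 then fun f => fclose (fforall f) else id.

Section SatConnectives.
Variable G : cogType.

Lemma sat_fforall n (f : formula n.+1) (e : n.-tuple G) :
  sat (fforall f) e <-> forall x, sat f [tuple of x :: e].
Proof.
split=> [/= h x|h /= [x]]; last exact.
by apply: contrapT => nf; apply: h; exists x.
Qed.

Lemma sat_fdisj n (f g : formula n) (e : n.-tuple G) :
  sat (fdisj f g) e <-> sat f e \/ sat g e.
Proof.
split=> [/= h|[] h /= []//]; apply: contrapT => /not_orP[nf ng].
exact: h.
Qed.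

Lemma sat_fimp n (f g : formula n) (e : n.-tuple G) :
  sat (fimp f g) e <-> (sat f e -> sat g e).
Proof.
split=> [/= h hf|h /= [/h hg]//]; apply: contrapT => ng.
by apply: h.
Qed.

Lemma sat_fand n (f g : formula n) (e : n.-tuple G) :
  sat (FAnd f g) e <-> sat f e /\ sat g e.
Proof. by []. Qed.

Lemma sat_fex n (f : formula n.+1) (e : n.-tuple G) :
  sat (FEx f) e <-> exists x, sat f [tuple of x :: e].
Proof. by []. Qed.

Lemma sat_fconjs n m (F : nat -> formula n) (e : n.-tuple G) :
  sat (fconjs m F) e <-> forall i, (i < m)%N -> sat (F i) e.
Proof.
elim: m => [|m IH] /=; first by split.
split=> [[h /IH h'] i|h].
  by rewrite ltnS leq_eqVlt => /orP[/eqP ->//|/h'].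
by split; [exact: h|apply/IH => i im; apply: h; exact: ltnW].
Qed.

Lemma sat_fcycs n (ts : seq (term n)) (e : n.-tuple G) :
  sat (fcycs ts) e <-> cycs (map (eval e) ts).
Proof.
have [|ts2] := eqVneq (size ts) 2%N; first by case: ts => [|t [|u []]].
rewrite cycsE ?size_map//.
have -> : fcycs ts = fconjs (size ts) (fun k => fconjs k (fun j => fconjs j (fun i =>
           FCyc (nth TZero ts i) (nth TZero ts j) (nth TZero ts k)))).
  by case: ts ts2 => [|t [|u []]].
split=> [/sat_fconjs h i j k /andP[ij jk] kt|h].
  have jt := ltn_trans jk kt; have it := ltn_trans ij jt.
  rewrite !(nth_map TZero)//.
  by have /sat_fconjs/(_ _ jk)/sat_fconjs/(_ _ ij) := h _ kt.
apply/sat_fconjs => k kt; apply/sat_fconjs => j jk; apply/sat_fconjs => i ij.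
have jt := ltn_trans jk kt; have it := ltn_trans ij jt.
by have := h i j k; rewrite ij jk !(nth_map TZero)//=; apply.
Qed.

Lemma eval_tmuln n (t : term n) (e : n.-tuple G) k : eval e (tmuln t k) = eval e t *+ k.
Proof. by elim: k => //= k ->; rewrite mulrS. Qed.

Lemma sat_fclose n (f : formula n) :
  sat (fclose f) [tuple of [::] : seq G] <-> forall e : n.-tuple G, sat f e.
Proof.
elim: n f => [|n IH] f /=.
  split=> [h e|]; last exact.
  by rewrite (_ : e = [tuple of [::]])//; apply: val_inj; case: e => [[]].
apply: iff_trans (IH _) _; split=> [h e|h e]; last by apply/sat_fforall => x; exact: h.
case/tupleP: e => x e; exact: ((sat_fforall _ _).1 (h e) x).
Qed.

End SatConnectives.

Definition fregular_body (m : nat) : formula m.+2 :=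
  let x1 := TVar (lift ord0 ord0) : term m.+3 in
  let xn := TVar (lift ord0 ord_max) : term m.+3 in
  let nx := tmuln (TVar ord0) m.+2 : term m.+3 in
  fimp (fcycs (TZero :: [seq TVar i | i <- enum 'I_m.+2]))
    (FEx (FAnd (fdisj (FEq nx x1) (fdisj (FEq nx xn) (FCyc x1 nx xn)))
      (fcycs (rcons (mkseq (fun i => tmuln (TVar ord0) i) m.+2) xn)))).

Lemma sat_fregular (G : cogType) (m : nat) :
  sat (fclose (fregular_body m)) [tuple of [::] : seq G] <-> c_n_regular G m.+2.
Proof.
apply: iff_trans (sat_fclose _ _) _.
suff E (s : m.+2.-tuple G) : sat (fregular_body m) s <->
    (cycs (0 :: s) -> exists x : G,
    [\/ x *+ m.+2 = head 0 s, x *+ m.+2 = last 0 s | cyc (head 0 s) (x *+ m.+2) (last 0 s)] /\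
    cycs (rcons (mkseq (fun i => x *+ i) m.+2) (last 0 s))).
  by split=> h s; [exact: (E s).1 (h s)|exact: (E s).2 (h s)].
have E1 : map (eval s) (TZero :: [seq TVar i | i <- enum 'I_m.+2]) = 0 :: s.
  by rewrite /= -map_comp -[in RHS](map_tnth_enum s); congr (_ :: _); apply: eq_map.
have eh x : eval [tuple of x :: s] (TVar (lift ord0 ord0)) = head 0 s.
  by rewrite /= tnthS (tnth_nth 0) nth0.
have el x : eval [tuple of x :: s] (TVar (lift ord0 ord_max)) = last 0 s.
  by rewrite /= tnthS (tnth_nth 0) (last_nth 0) size_tuple.
have em x k : eval [tuple of x :: s] (tmuln (TVar ord0) k) = x *+ k.
  by rewrite eval_tmuln.
have E2 x : map (eval [tuple of x :: s]) (rcons (mkseq (fun i => tmuln (TVar ord0) i) m.+2)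
     (TVar (lift ord0 ord_max))) = rcons (mkseq (fun i => x *+ i) m.+2) (last 0 s).
  rewrite map_rcons el; congr rcons; rewrite -map_comp; apply: eq_map => i.
  exact: em.
have E3 x f1 : sat (fdisj (FEq (tmuln (TVar ord0) m.+2) (TVar (lift ord0 ord0))) f1)
    [tuple of x :: s] <-> x *+ m.+2 = head 0 s \/ sat f1 [tuple of x :: s].
  by apply: iff_trans (sat_fdisj _ _ _) _; rewrite -(eh x) -em.
have E4 x f1 : sat (fdisj (FEq (tmuln (TVar ord0) m.+2) (TVar (lift ord0 ord_max))) f1)
    [tuple of x :: s] <-> x *+ m.+2 = last 0 s \/ sat f1 [tuple of x :: s].
  by apply: iff_trans (sat_fdisj _ _ _) _; rewrite -(el x) -em.
have E5 x : sat (FCyc (TVar (lift ord0 ord0)) (tmuln (TVar ord0) m.+2) (TVar (lift ord0 ord_max)))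
    [tuple of x :: s] <-> cyc (head 0 s) (x *+ m.+2) (last 0 s).
  by rewrite -(eh x) -(el x) -em.
apply: iff_trans (sat_fimp _ _ _) _; split=> h cs.
  have /h/sat_fex[x /sat_fand[/E3 hx /sat_fcycs]] : sat (fcycs (TZero :: [seq TVar i | i <- enum 'I_m.+2])) s.
    by apply/sat_fcycs; rewrite E1.
  rewrite E2 => hc; exists x; split=> //; case: hx => [|/E4[|/E5]] hx;
    by [constructor 1|constructor 2|constructor 3].
have [x [hx hc]] : exists x : G,
    [\/ x *+ m.+2 = head 0 s, x *+ m.+2 = last 0 s | cyc (head 0 s) (x *+ m.+2) (last 0 s)] /\
    cycs (rcons (mkseq (fun i => x *+ i) m.+2) (last 0 s)).
  by apply: h; rewrite -E1; apply/sat_fcycs.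
apply/sat_fex; exists x; apply/sat_fand; split; last by apply/sat_fcycs; rewrite E2.
by apply/E3; case: hx => hx; [left|right; apply/E4; left|right; apply/E4; right; apply/E5].
Qed.

Definition fone : formula 1 :=
  FAnd (FNot (FEq (TVar ord0) TZero))
    (fforall (fimp (FNot (FEq (TVar ord0) TZero))
      (fimp (FNot (FEq (TVar ord0) (TVar (lift ord0 ord0))))
        (FCyc TZero (TVar (lift ord0 ord0)) (TVar ord0))))).

Lemma sat_fone (G : cogType) (x : G) (e : 0.-tuple G) :
  sat fone [tuple of x :: e] <-> is_one x.
Proof.
split=> [/sat_fand[x0 h]|[x0 h]].
  split=> [|y y0 yx]; first exact: x0.
  by have /sat_fforall/(_ y)/sat_fimp/(_ y0)/sat_fimp/(_ yx) := h.
apply/sat_fand; split; first exact: x0.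
by apply/sat_fforall => y; apply/sat_fimp => y0; apply/sat_fimp => yx; exact: h.
Qed.

Definition fdiscrete : sentence := fdisj (fforall (FEq (TVar ord0) TZero)) (FEx fone).

Lemma sat_fdiscrete (G : cogType) :
  sat fdiscrete [tuple of [::] : seq G] <-> discrete G.
Proof.
apply: iff_trans (sat_fdisj _ _ _) _; split=> -[h|[x hx]].
- by left=> x; exact: ((sat_fforall _ _).1 h x).
- by right; exists x; exact: ((sat_fone _ _).1 hx).
- by left; apply/sat_fforall => x; exact: h.
- by right; exists x; exact: ((sat_fone _ _).2 hx).
Qed.

Definition fD (q k : nat) : sentence :=
  FEx (FAnd fone (FEx (FAnd (fcycs (mkseq (fun i => tmuln (TVar ord0) i) q))
    (FEq (tmuln (TVar ord0) q) (tmuln (TVar (lift ord0 ord0)) k))))).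

(** [oneG] defaults to [0], whereas the sentence binds an actual least element; hence the extra
    conjunct. *)
Lemma sat_fD (G : cogType) (q k : nat) :
  sat (fD q k) [tuple of [::] : seq G] <-> (exists e : G, is_one e) /\ D G q k.
Proof.
have M (x e : G) (s : 0.-tuple G) : map (eval [tuple of x :: [tuple of e :: s]])
   (mkseq (fun i => tmuln (TVar ord0) i) q) = mkseq (fun i => x *+ i) q.
  rewrite -map_comp; apply: eq_map => i; exact: eval_tmuln.
split=> [[e [/sat_fone he [x [/sat_fcycs + /=]]]]|[[e he] [x [cx ex]]]].
  rewrite M !eval_tmuln => cx ex; split; first by exists e.
  exists x; split=> //; rewrite (_ : oneG G = e)//.
  apply: is_one_uniq (he); exact: (xgetPex 0 (ex_intro _ e he)).
exists e; split; first exact/sat_fone.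
exists x; split; first by apply/sat_fcycs; rewrite M.
rewrite /= !eval_tmuln /= [LHS]ex (_ : oneG G = e)//.
apply: is_one_uniq (he); exact: (xgetPex 0 (ex_intro _ e he)).
Qed.

(** * The groups Z/nZ *)

Lemma cyc_ordE m (a b c : 'I_m.+1) :
  cyc a b c <-> [|| (a < b < c)%N, (b < c < a)%N | (c < a < b)%N].
Proof. by []. Qed.

Lemma ord_discrete m : discrete 'I_m.+1.
Proof.
case: m => [|m]; [left=> x; exact: ord1|right; exists (inord 1)].
have e1 : (inord 1 : 'I_m.+2) = 1%N :> nat by rewrite inordK.
split=> [/(congr1 val)|x /eqP x0 /eqP x1]; first by rewrite /= e1.
rewrite -!val_eqE /= e1 in x0 x1.
by apply/cyc_ordE; rewrite e1 /=; apply/orP; left; lia.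
Qed.

Lemma ord_mulrn m (x : 'I_m.+1) i : (x * i < m.+1)%N -> x *+ i = (x * i)%N :> nat.
Proof.
elim: i => [|i IH]; first by rewrite muln0.
rewrite mulnS => h; rewrite mulrS /= IH; last by lia.
by rewrite modn_small.
Qed.

(** The [q] elements are increasing integers, so from first to last they span [q] consecutive
    integers, one of which is a multiple of [q]; being below the modulus, it is reached without a
    turn. *)
Lemma ord_c_regular m : c_regular 'I_m.+1.
Proof.
case=> [|[|n]]// _; set q := n.+2 => s /cycsE; rewrite /= size_tuple => /(_ isT) cs.
have L i j : (i < j)%N -> (j < q)%N -> (0 < nth 0%R s i < nth 0%R s j)%N.
  move=> ij jq; have := cs 0%N i.+1 j.+1; rewrite /= ltnS ij => /(_ isT jq) /cyc_ordE.
  by rewrite /=; lia.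
have L' j : (j < q)%N -> (nth 0%R s 0 + j <= nth 0%R s j)%N.
  elim: j => [|j IH] jq; first by rewrite addn0.
  by have /andP[_] := L _ _ (ltnSn j) jq; have := IH (ltnW jq); lia.
have eh : head 0 s = nth 0 s 0 by rewrite nth0.
have el : last 0 s = nth 0 s n.+1 by rewrite (last_nth 0) size_tuple.
rewrite eh el.
set x1 := nth 0 s 0; set xn := nth 0 s n.+1.
have x1n : (x1 + n.+1 <= xn)%N by exact: L'.
have x10 : (0 < x1)%N by have /andP[] := L 0%N 1%N isT isT.
have xm := ltn_ord xn.
(* The ceiling of [x1 / q], as [n.+1 = q - 1]. *)
pose y := ((x1 + n.+1) %/ q)%N.
have y1 : (x1 <= y * q)%N.
  have := divn_eq (x1 + n.+1) q; have := @ltn_pmod (x1 + n.+1) q isT.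
  by rewrite -/y; lia.
have y2 : (y * q <= xn)%N by apply: leq_trans x1n; exact: leq_divM.
have yi i : (i <= q)%N -> (y * i < m.+1)%N.
  by move=> iq; apply: leq_ltn_trans xm; apply: leq_trans y2; rewrite leq_mul2l iq orbT.
have y0 : (0 < y)%N by lia.
have ey : (inord y : 'I_m.+1) = y :> nat by rewrite inordK//; have := yi 1%N isT; rewrite muln1.
have eM i : (i <= q)%N -> (inord y : 'I_m.+1) *+ i = (y * i)%N :> nat.
  by move=> iq; rewrite ord_mulrn ey// yi.
exists (inord y); split.
  case: (ltngtP x1 (y * q)%N) y1 => // [h|h] _; last first.
    by constructor 1; apply: ord_inj; rewrite eM// -h.
  case: (ltngtP (y * q)%N xn) y2 => // [h'|h'] _; last first.
    by constructor 2; apply: ord_inj; rewrite eM// h'.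
  by constructor 3; apply/cyc_ordE; rewrite eM// h h'.
have sz : size (rcons (mkseq (fun i => (inord y : 'I_m.+1) *+ i) q) xn) != 2%N.
  by rewrite size_rcons size_mkseq.
apply/(cycsE sz) => i j k /andP[ij jk]; rewrite size_rcons size_mkseq => kq.
have nx p : (p < q.+1)%N -> (nth 0%R (rcons (mkseq (fun i => inord y *+ i) q) xn) p : nat) =
    if p == q then xn : nat else (y * p)%N.
  rewrite nth_rcons size_mkseq ltnS leq_eqVlt => /orP[/eqP->|pq].
    by rewrite ltnn !eqxx.
  by rewrite pq (ltn_eqF pq) nth_mkseq// eM// ltnW.
have jq := ltn_trans jk kq; have iq := ltn_trans ij jq.
apply/cyc_ordE; rewrite !nx//.
have -> : (i == q) = false by lia.
have -> : (j == q) = false by lia.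
have hij : (y * i < y * j)%N by rewrite ltn_pmul2l.
apply/orP; left; rewrite hij /=; case: eqP => [ek|_]; last by rewrite ltn_pmul2l.
by apply: leq_trans y2; rewrite ltn_pmul2l// -ek.
Qed.

(** * Characteristic families *)

Lemma ddvd_nat (V : dogType) (q k : nat) : (0 < q)%N ->
  ddvd q (dog1 *+ k : V) <-> (q %| k)%N.
Proof. by case: q => // q _; rewrite pmulrn; exact: ddvd_dog1. Qed.

Lemma ddvd_residue (V : dogType) (q s t : nat) (v : V) : (0 < q)%N ->
  ddvd q (v + dog1 *+ s) -> ddvd q (v + dog1 *+ t) <-> s = t %[mod q].
Proof.
case: q => // q _ dv.
have -> : v + dog1 *+ t = (v + dog1 *+ s) + dog1 *~ (Posz t - Posz s).
  by rewrite mulrzBr -!pmulrn -addrA [_ + (_ - _)]addrC subrK.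
apply: iff_trans (ddvdD _ dv) _; apply: iff_trans (ddvd_dog1 _ _ _) _.
rewrite -eqz_mod_dvd !modz_nat eqz_nat; split=> [/eqP->|->]//.
Qed.

(** The class of [-s]: for [s < q] and [j] large, [D_{q,s}] holds in Z/j exactly when [j] is in
    it. *)
Definition opp_residue (q s : nat) : set posnat := [set j | (q %| val j + s)%N].

Lemma digit_sum_lt (phi : char_seq) p n : (digit_sum phi p n < val p ^ val n)%N.
Proof.
rewrite /digit_sum; elim: (val n) => [|m IH]; first by rewrite big_ord0 expn0.
rewrite big_ord_recr /= expnS.
have h := ltn_ord (phi p (posS m)).
apply: (@leq_trans ((phi p (posS m)).+1 * val p ^ m)%N).
  by rewrite mulSn ltn_add2r.
by rewrite leq_mul2r h orbT.
Qed.

(** This puts the characteristic sets in the same form as the condition that [p^n] divides [z + k].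
    The cofactor [m] is positive because [j] is. *)
Lemma char_setE (phi : char_seq) p n :
  char_set phi p n = opp_residue (val p ^ val n) (digit_sum phi p n).
Proof.
have dl := digit_sum_lt phi p n.
apply/seteqP; split=> j /=.
  case=> m ej; rewrite /opp_residue /= ej subnK ?dvdn_mulr//.
  by apply: leq_trans (ltnW dl) _; rewrite leq_pmulr// (valP m).
move=> /dvdnP[m em]; have m0 : (0 < m)%N.
  by case: m em => //; have := valP j; lia.
by exists (exist _ m m0); rewrite /= mulnC -em addnK.
Qed.

(** A coherent system of residues is a p-adic integer for each p, and [phi] lists its digits. It
    serves twice: for the residues of [- z], and for the classes belonging to an ultrafilter. *)
Lemma digits_exist (C : nat -> nat -> Prop) :
  (forall q, (0 < q)%N -> exists2 s, (s < q)%N & C q s) ->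
  (forall q s t, (0 < q)%N -> C q s -> C q t -> s = t %[mod q]) ->
  (forall q m s, C (q * m)%N s -> C q s) ->
  exists phi : char_seq, forall p n, C (val p ^ val n)%N (digit_sum phi p n).
Proof.
move=> ex uniq dvd.
have [r rP] : exists r : nat -> nat, forall q, (0 < q)%N -> (r q < q)%N /\ C q (r q).
  exists (fun q => xget 0%N [set s | (s < q)%N /\ C q s]) => q q0.
  have h : exists s, (s < q)%N /\ C q s by have [s sq Cs] := ex _ q0; exists s.
  exact: (xgetPex 0%N h).
have p0 (p : primenat) n : (0 < val p ^ n)%N by rewrite expn_gt0 prime_gt0// (valP p).
(* The n-th digit is the quotient by [p^(n-1)] of the residue modulo [p^n]. *)
have digP (p : primenat) (n : posnat) : (r (val p ^ val n) %/ val p ^ (val n).-1 < val p)%N.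
  rewrite ltn_divLR// -expnS prednK ?(valP n)//.
  by case: (rP _ (p0 p (val n))).
exists (fun p n => Ordinal (digP p n)) => p n.
suff -> : digit_sum (fun p n => Ordinal (digP p n)) p n = r (val p ^ val n)%N.
  by case: (rP _ (p0 p (val n))).
rewrite /digit_sum /=; elim: (val n) => [|m IH].
  by rewrite big_ord0; have [] := rP _ (p0 p 0%N); rewrite expn0; lia.
rewrite big_ord_recr /= IH.
have [r1 C1] := rP _ (p0 p m); have [r2 C2] := rP _ (p0 p m.+1).
have := uniq _ _ _ (p0 p m) C1 (dvd _ (val p) _ _); rewrite mulnC -expnS => /(_ _ C2).
rewrite (modn_small r1) => ->.
by rewrite addnC -divn_eq.
Qed.

(** * Comparison with ultraproducts *)

Section Compare.
Variables (U : set_system posnat) (UF : UltraFilter U).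

Lemma regular_discrete_ultraproduct (G : cogType) :
  elementarily_equivalent G (ultraproduct UF Zn) -> c_regular G /\ discrete G.
Proof.
move=> eqG; split=> [[|[|m]]// _|].
  apply/sat_fregular/eqG/sat_ultra0; apply: filterS filterT => j _.
  by apply/sat_fregular/ord_c_regular.
apply/sat_fdiscrete/eqG/sat_ultra0; apply: filterS filterT => j _.
exact/sat_fdiscrete/ord_discrete.
Qed.

(** For each sentence, [sat_residue] compares [G] with Z/j for all [j] in a set of [U], and Los's
    theorem concludes. *)
Lemma equiv_ultraproduct (G : cogType) (W : unwinding G) : z_group W -> ularge W ->
  (forall B, U [set j | (B < val j)%N]) ->
  (forall q s, (0 < q)%N -> ddvd q (uz W + dog1 *+ s) -> U (opp_residue q s)) ->
  elementarily_equivalent G (ultraproduct UF Zn).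
Proof.
move=> zW lW UB Uq f; apply: iff_trans _ (iff_sym (@sat_ultra0 _ _ _ _ _)).
have [M [B [M0 H]]] := sat_residue f.
have [w [r [rM ez]]] := z_group_mod (uz W) zW M0.
(* [r * M.-1] is a natural number congruent to [-r] modulo [M]. *)
have dM : ddvd M (uz W + dog1 *+ (r * M.-1)).
  exists (w + dog1 *+ r); rewrite ez mulrnDl -addrA -mulrnDr -mulnS prednK//.
  by rewrite mulrnA.
have Uj : U ([set j | (B < val j)%N] `&` opp_residue M (r * M.-1)).
  by apply: filterI (UB B) _; exact: Uq.
have E (j : posnat) : (B < val j)%N -> opp_residue M (r * M.-1) j ->
    (sat f [tuple of [::] : seq G] <-> sat f [tuple of [::] : seq (Zn j)]).
  move=> Bj /dvdnP[k ek].
  have ej : uz (int_unwinding (val j).-1) = dog1 *+ val j.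
    by rewrite uz_int prednK// (valP j).
  apply: (H _ _ W (int_unwinding (val j).-1) w (dog1 *~ (Posz k - Posz r)) r) => //.
  - exact: int_dog_zgroup.
  - by rewrite ej !pmulrn dltMz ?dog1_gt0.
  rewrite ej !pmulrn -mulrzA -mulrzDr; congr (_ *~ _).
  have := prednK M0; nia.
split=> [sf|/(filterI Uj)/filter_ex[j [[Bj Mj] sj]]]; last exact/(E j).
by apply: filterS Uj => j [Bj Mj]; apply/(E j).
Qed.

Lemma nonprincipal_large : ~ principal U -> forall B, U [set j | (B < val j)%N].
Proof.
move=> np; elim=> [|B IH].
  by apply: filterS filterT => j _; exact: (valP j).
have [UB|UB] := in_ultra_setVsetC [set j : posnat | val j = B.+1] UF; last first.
  apply: filterS (filterI IH UB) => j /= [Bj jB].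
  by rewrite ltn_neqAle Bj andbT eq_sym; apply/eqP.
case: np; exists (exist _ B.+1 (ltn0Sn B)); apply/seteqP; split=> A.
  move=> UA; have [j [Aj jB]] := filter_ex (filterI UA UB).
  move=> _ ->; rewrite (_ : exist _ _ _ = j)//; exact: val_inj.
move=> pA; apply: filterS UB => j jB; apply: pA; exact: val_inj.
Qed.

End Compare.

(** * Residue classes and ultrafilters *)

Lemma opp_residue_mod q s t : s = t %[mod q] -> opp_residue q s = opp_residue q t.
Proof.
move=> e; apply/seteqP; split=> j; rewrite /opp_residue /= /dvdn -modnDmr.
  by rewrite e modnDmr.
by rewrite -e modnDmr.
Qed.

Lemma dvdn_add_mod q j s t : (q %| j + s)%N -> (q %| j + t)%N -> s = t %[mod q].
Proof.
move=> /eqP js /eqP jt; apply/eqP; rewrite -(eqn_modDl j) js jt.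
exact: eqxx.
Qed.

Lemma ex_opp_residue (V : dogType) (v : V) q : z_group V -> (0 < q)%N ->
  exists2 s, (s < q)%N & ddvd q (v + dog1 *+ s).
Proof.
move=> zV q0; have [w [s [sq es]]] := z_group_mod (- v) zV q0.
by exists s => //; exists (- w); rewrite mulNrn -[v]opprK es opprD subrK.
Qed.

(** The sets [S] are nonempty, and [S] at [(q * q', maxn B B')] is contained in both [S (q, B)] and
    [S (q', B')]; they thus generate a proper filter. *)
Lemma exists_ultrafilter (G : cogType) (W : unwinding G) : z_group W ->
  exists2 U : set_system posnat, UltraFilter U &
  (forall B, U [set j | (B < val j)%N]) /\
  (forall q s, (0 < q)%N -> ddvd q (uz W + dog1 *+ s) -> U (opp_residue q s)).
Proof.
move=> zW.
pose S (p : nat * nat) : set posnat := [set j | (p.2 < val j)%N /\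
  forall s, ddvd p.1 (uz W + dog1 *+ s) -> opp_residue p.1 s j].
pose F := filter_from [set p : nat * nat | (0 < p.1)%N] S.
have S0 q B : (0 < q)%N -> S (q, B) !=set0.
  move=> q0; have [s sq ds] := ex_opp_residue (uz W) zW q0.
  (* This element of the class of [-s] exceeds [B] because [s < q]. *)
  have j0 : (0 < q * B.+2 - s)%N by nia.
  exists (exist (fun n => (0 < n)%N) _ j0); split=> [/=|t dt]; first by nia.
  have e := (ddvd_residue t q0 ds).1 dt.
  rewrite -(opp_residue_mod e) /opp_residue /= subnK ?dvdn_mulr//.
  by nia.
have FF : Filter F.
  apply: filter_from_filter; first by exists (1, 0)%N.
  case=> q B [q' B'] /= q0 q'0; exists ((q * q')%N, maxn B B'); first by rewrite /= muln_gt0 q0.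
  have qq0 : (0 < q * q')%N by rewrite muln_gt0 q0.
  move=> j [/= hj H]; rewrite gtn_max in hj; have /andP[hB hB'] := hj.
  have [s _ ds] := ex_opp_residue (uz W) zW qq0.
  have /= js := H _ ds.
  have A m t : (0 < m)%N -> (m %| q * q')%N -> ddvd m (uz W + dog1 *+ t) -> opp_residue m t j.
    move=> m0 /dvdnP[k ek] dt; have ds' : ddvd m (uz W + dog1 *+ s).
      by have [y ->] := ds; exists (y *+ k); rewrite ek mulrnA.
    rewrite -(opp_residue_mod ((ddvd_residue t m0 ds').1 dt)).
    by apply: dvdn_trans js; rewrite ek dvdn_mull.
  split; split=> // t dt; first by apply: (A q t q0 _ dt); exact: dvdn_mulr.
  by apply: (A q' t q'0 _ dt); exact: dvdn_mull.
have FP : ProperFilter F by apply: filter_from_proper => -[q B]; exact: S0.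
have [U [UU FU]] := ultraFilterLemma FP; exists U => //; split=> [B|q s q0 ds].
  by apply: FU; exists (1, B)%N => // j [].
by apply: FU; exists (q, 0)%N => // j [_]; apply.
Qed.

Lemma equiv_principal (n : posnat) :
  elementarily_equivalent (Zn n) (ultraproduct (principal_filter_ultra n) Zn).
Proof.
move=> f; apply: iff_trans _ (iff_sym (@sat_ultra0 _ _ _ _ _)).
by apply: iff_sym; exact: principal_filterP.
Qed.

Lemma infinite_ularge (G : cogType) (W : unwinding G) : infinite_set [set: G] -> ularge W.
Proof.
move=> Ginf; case: (uz_dichotomy W) => // -[N eN]; case: Ginf.
apply: sub_finite_set (finite_image (fun k => xget 0 [set a | urep W a = dog1 *+ k]) (finite_II N.+1)).
move=> a _; have [|k kN ek] := @le_dog1_muln _ (urep W a) N (urep_ge0 W a).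
  by rewrite -eN ltW// urep_lt.
exists k => //; apply: (@urep_inj _ W); rewrite ek.
exact: (xgetPex 0 (ex_intro (fun b => urep W b = dog1 *+ k) a ek)).
Qed.

(** [D_ddvd] turns [D] into divisibility of [z + k], which holds for only one [k] below [p^n]. *)
Lemma is_char_seqP (G : cogType) (W : unwinding G) (phi : char_seq) : ularge W ->
  is_char_seq G phi <->
  forall (p : primenat) (n : posnat), ddvd (val p ^ val n)%N (uz W + dog1 *+ digit_sum phi p n).
Proof.
move=> lW.
have q1 (p : primenat) (n : posnat) : (1 < val p ^ val n)%N.
  by rewrite -{1}(expn0 (val p)) ltn_exp2l ?prime_gt1 ?(valP p)// (valP n).
have DE (p : primenat) (n : posnat) k : (k < val p ^ val n)%N ->
    D G (val p ^ val n)%N k <-> ddvd (val p ^ val n)%N (uz W + dog1 *+ k).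
  by move=> kq; exact: (D_ddvd (q1 p n) kq (lW _)).
split=> [h p n|h p n k kq].
  by apply/DE; [exact: digit_sum_lt|exact/(h p n _ (digit_sum_lt phi p n))].
apply: iff_trans (DE _ _ _ kq) _; split=> [dk|->//].
have := (ddvd_residue k (ltnW (q1 p n)) (h p n)).1 dk.
by rewrite !modn_small// digit_sum_lt.
Qed.

Lemma exists_char_seq (G : cogType) (W : unwinding G) : z_group W -> ularge W ->
  exists phi, is_char_seq G phi.
Proof.
move=> zW lW.
have [q q0|q s t q0|q m s|phi h] := @digits_exist (fun q s => ddvd q (uz W + dog1 *+ s)).
- exact: ex_opp_residue.
- by move=> ds /(ddvd_residue t q0 ds).
- by case=> y ->; exists (y *+ m); rewrite -mulrnA mulnC.
- by exists phi; apply/(is_char_seqP _ lW).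
Qed.

Lemma ultra_opp_residue (U : set_system posnat) (UF : UltraFilter U) q : (0 < q)%N ->
  exists2 s, (s < q)%N & U (opp_residue q s).
Proof.
move=> q0; apply: contrapT => N.
have H m : (m <= q)%N -> U [set j | forall s, (s < m)%N -> ~ opp_residue q s j].
  elim: m => [|m IH] mq; first by apply: filterS filterT.
  have [Um|Um] := in_ultra_setVsetC (opp_residue q m) UF.
    by case: N; exists m.
  apply: filterS (filterI (IH (ltnW mq)) Um) => j [/= h1 h2] s.
  by rewrite ltnS leq_eqVlt => /orP[/eqP ->//|/h1].
have [j /= hj] := filter_ex (H q (leqnn q)).
(* The residue of [- j], so that [j] lies in a class supposedly excluded. *)
apply: (hj (val j * q.-1 %% q)%N); first exact: ltn_pmod.
rewrite (@opp_residue_mod _ _ (val j * q.-1)%N) ?modn_mod//.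
by rewrite /opp_residue /= -mulnS prednK// dvdn_mull.
Qed.

Lemma ultra_char_seq (U : set_system posnat) (UF : UltraFilter U) :
  exists phi, char_family phi `<=` U.
Proof.
have [q q0|q s t q0 Us Ut|q m s|phi h] := @digits_exist (fun q s => U (opp_residue q s)).
- exact: ultra_opp_residue.
- have [j [/= h1 h2]] := filter_ex (filterI Us Ut); exact: dvdn_add_mod h1 h2.
- by apply: filterS => j; apply: dvdn_trans; exact: dvdn_mulr.
- by exists phi => A [p [n ->]]; rewrite char_setE.
Qed.

Lemma char_family_sub_uniq (U : set_system posnat) (UF : UltraFilter U) phi psi :
  char_family phi `<=` U -> char_family psi `<=` U -> char_family phi = char_family psi.
Proof.
move=> hphi hpsi.
have E p n : digit_sum phi p n = digit_sum psi p n.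
  have U1 : U (char_set phi p n) by apply: hphi; exists p, n.
  have U2 : U (char_set psi p n) by apply: hpsi; exists p, n.
  have [j []] := filter_ex (filterI U1 U2); rewrite !char_setE => h1 h2.
  by have := dvdn_add_mod h1 h2; rewrite !modn_small// digit_sum_lt.
by apply/seteqP; split=> A [p [n ->]]; exists p, n; rewrite !char_setE E.
Qed.

(** The family controls prime powers only. Since [U] contains the class of some [- t] modulo [q], it
    remains to compare [t] with [s] at each prime power exactly dividing [q]. *)
Lemma char_family_opp_residue (G : cogType) (W : unwinding G) (U : set_system posnat)
    (UF : UltraFilter U) phi q s : z_group W -> ularge W ->
  is_char_seq G phi -> char_family phi `<=` U -> (0 < q)%N ->
  ddvd q (uz W + dog1 *+ s) -> U (opp_residue q s).
Proof.
move=> zW lW /(is_char_seqP _ lW) cphi hphi q0 ds.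
have [t _ Ut] := ultra_opp_residue UF q0.
suff e : s = t %[mod q] by rewrite (opp_residue_mod e).
(* A natural residue [r] of [z] reduces the claim to natural numbers, where divisibility is checked
   prime by prime. *)
have [w [r [rq er]]] := z_group_mod (uz W) zW q0.
have E m : (0 < m)%N -> (m %| q)%N -> forall i, ddvd m (uz W + dog1 *+ i) <-> (m %| r + i)%N.
  move=> m0 /dvdnP[k ek] i; rewrite er -addrA -mulrnDr.
  apply: iff_trans (ddvd_nat _ _ m0); apply: ddvdD.
  by exists (w *+ k); rewrite ek mulrnA.
apply: (@dvdn_add_mod q r); first exact/(E q).
apply/dvdn_partP => // p pq; rewrite p_part.
have pP : prime p by move: pq; rewrite mem_primes => /andP[].
have a0 : (0 < logn p q)%N by rewrite logn_gt0.
pose pp : primenat := exist _ p pP; pose a : posnat := exist _ (logn p q) a0.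
have m0 : (0 < p ^ logn p q)%N by rewrite expn_gt0 prime_gt0.
have mq : (p ^ logn p q %| q)%N by exact: pfactor_dvdnn.
have h1 : (p ^ logn p q %| r + digit_sum phi pp a)%N by apply/(E _ m0 mq); exact: (cphi pp a).
have U1 : U (char_set phi pp a) by apply: hphi; exists pp, a.
have [j [/= jphi jt]] := filter_ex (filterI U1 Ut); rewrite char_setE in jphi.
have e := dvdn_add_mod jphi (dvdn_trans mq jt).
by rewrite /dvdn -modnDmr -e modnDmr.
Qed.

Theorem corollary4p33 (G : cogType) :
  (infinite_set [set: G] -> c_regular G -> discrete G ->
   forall (U : set_system posnat) (UF : UltraFilter U), ~ principal U ->
     (elementarily_equivalent G (ultraproduct UF Zn) <->
      family_of_group G = family_of_ultrafilter U))
  /\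
  (c_regular G /\ discrete G <->
   exists (U : set_system posnat) (UF : UltraFilter U),
     elementarily_equivalent G (ultraproduct UF Zn)).
Proof.
split=> [Ginf rG dG U UF np|]; last first.
  split=> [[rG dG]|[U [UF /regular_discrete_ultraproduct//]]].
  have [W zW] := exists_unwinding rG dG.
  (* If [z] is the standard [N], then [G] is equivalent to Z/N, and the principal ultrafilter at [N]
     serves. *)
  case: (uz_dichotomy W) => [[N eN]|lW].
    have N0 : (0 < N)%N by case: N eN (uz_gt0 W) => // ->; rewrite mulr0n ltxx.
    pose n : posnat := exist _ N N0.
    exists (principal_filter n), (principal_filter_ultra n) => f.
    apply: iff_trans (equiv_principal n f).
    apply: (@equiv_std _ _ W (int_unwinding (val n).-1) N) => //.
      exact: int_dog_zgroup.
    by rewrite uz_int prednK.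
  have [U UF [UB Uq]] := exists_ultrafilter zW.
  exists U, UF; exact: equiv_ultraproduct zW lW UB Uq.
have [W zW] := exists_unwinding rG dG.
have lW := infinite_ularge W Ginf.
have UB := nonprincipal_large UF np.
(* Such sequences exist, so neither [get] falls back on its default. *)
have cphi : is_char_seq G (get [set phi | is_char_seq G phi]).
  exact: (getPex (exists_char_seq zW lW)).
have hpsi : char_family (get [set phi | char_family phi `<=` U]) `<=` U.
  exact: (getPex (ultra_char_seq UF)).
rewrite /family_of_group /family_of_ultrafilter.
move: (get _) cphi => phi cphi; move: (get _) hpsi => psi hpsi.
split=> [eqG|e]; last first.
  apply: (@equiv_ultraproduct U UF G W zW lW UB _) => q s q0 ds.
  by apply: (char_family_opp_residue UF zW lW cphi _ q0 ds); rewrite e.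
apply: (char_family_sub_uniq UF _ hpsi) => A [p [n ->]].
rewrite char_setE; set q := (val p ^ val n)%N; set k := digit_sum phi p n.
have q1 : (1 < q)%N.
  by rewrite -{1}(expn0 (val p)) ltn_exp2l ?prime_gt1 ?(valP p)// (valP n).
have kq : (k < q)%N := digit_sum_lt phi p n.
(* [D] passes through the ultraproduct to Z/j for almost all [j]; beyond [q * q] it says there that
   [q] divides [j + k]. *)
have : sat (fD q k) [tuple of [::] : seq G].
  apply/sat_fD; split; last exact/(cphi p n k kq).
  by have [e he _] := ex_is_one (W := W) (lW 1%N); exists e.
move=> /eqG/sat_ultra0 UD.
apply: filterS (filterI (UB (q * q)%N) UD) => j [/= qj /sat_fD[_]].
have ej : uz (int_unwinding (val j).-1) = dog1 *+ val j by rewrite uz_int prednK// (valP j).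
have dz : dog1 *+ (q * q) < uz (int_unwinding (val j).-1).
  by rewrite ej !pmulrn dltMz// dog1_gt0.
move=> /(D_ddvd q1 kq dz); rewrite ej -mulrnDr.
by move=> h; exact: (ddvd_nat _ _ (ltnW q1)).1 h.
Qed.
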